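(* Let $b\ge1$ and let $B_1,B_2,B_3,B_4$ be general $b\times b$ matrices over $k$. Write $E_{p,q}$ for a matrix unit and, for a scalar matrix $X=(x_{pq})$ and a $b\times b$ matrix $B$, write $X\otimes B$ for the block matrix with $(p,q)$ block $x_{pq}B$. Define block matrices $A_{iu}$ ($1\times3$ blocks), $A_{il}$ ($8\times3$ blocks), $A_{ir}$ ($8\times6$ blocks), $A_{id}$ ($10\times6$ blocks), $i=1,2,3$, by $$A_{1u}=E_{1,3}\otimes B_1,\quad A_{2u}=E_{1,2}\otimes B_1,\quad A_{3u}=E_{1,1}\otimes B_1;$$ $$\begin{aligned}A_{1l}&=(-2E_{1,1}+2E_{3,2}-E_{7,3})\otimes B_2,\\ A_{2l}&=(2E_{2,1}+2E_{4,3}+E_{7,2}-E_{8,2})\otimes B_2,\\ A_{3l}&=(2E_{5,2}+2E_{6,3}+E_{8,1})\otimes B_2;\end{aligned}$$ $$\begin{aligned}A_{1r}&=(E_{1,1}-2E_{2,5}+E_{3,2}+2E_{5,6}+\tfrac12E_{7,3}-E_{8,3})\otimes B_3,\\ A_{2r}&=(-2E_{1,4}+E_{2,1}-E_{4,3}-2E_{6,6}+\tfrac12E_{7,2}+\tfrac12E_{8,2})\otimes B_3,\\ A_{3r}&=(-2E_{3,4}+2E_{4,5}-E_{5,2}+E_{6,3}-E_{7,1}+\tfrac12E_{8,1})\otimes B_3;\end{aligned}$$ $$\begin{aligned}A_{1d}&=(3E_{1,4}+E_{4,1}+E_{5,5}+E_{6,2}+\tfrac12E_{8,6}+\tfrac18E_{10,3})\otimes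 B_4,\\ A_{2d}&=(3E_{2,5}+E_{4,4}+E_{5,1}+\tfrac12E_{7,3}+\tfrac14E_{9,6}+\tfrac18E_{10,2})\otimes B_4,\\ A_{3d}&=(3E_{3,6}+E_{6,4}+\tfrac12E_{7,5}+\tfrac12E_{8,2}+\tfrac14E_{9,3}+\tfrac18E_{10,1})\otimes B_4.\end{aligned}$$ Define representations of the $3$-arrow Kronecker quiver $K_3$ by $$N_1(a_i)=A_{ir},\quad N_2(a_i)=A_{id},\quad N_3(a_i)=\begin{pmatrix}A_{il}&A_{ir}\end{pmatrix},\quad N_4(a_i)=\begin{pmatrix}A_{il}&A_{ir}\\0&A_{id}\end{pmatrix},\quad N_5(a_i)=\begin{pmatrix}A_{iu}&0\\ A_{il}&A_{ir}\\0&A_{id}\end{pmatrix}.$$ Then, for every $a\ge1$, $c_{N_1}$, $c_{N_2}$, $c_{N_3}$, $c_{N_4}$, $c_{N_5}$ are semi-invariant functions for the tensors of size $3a\times5a\times3$, $3a\times4a\times3$, $9a\times19a\times3$, $a\times a\times3$, $9a\times8a\times3$, respectively.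
   Context: $k$ is a field of characteristic $0$. $K_n$ is the quiver with vertices $1,2$ and $n$ arrows $a_1,\dots,a_n$ from $1$ to $2$. Vectors are row vectors, so a representation $M$ of $K_n$ of dimension $(\alpha_1,\alpha_2)$ is an $n$-tuple of $\alpha_1\times\alpha_2$ matrices $M(a_i)$, acting by right multiplication on row vectors. The space $\mathrm{Rep}_\alpha(K_n)$ is identified with the space of tensors $U^*\otimes V\otimes W^*$ of size $\alpha_1\times\alpha_2\times n$, $\dim(U,V,W)=(\alpha_1,\alpha_2,n)$, where $W$ is the span of the arrows. $\mathrm{GL}_\alpha=\mathrm{GL}_{\alpha_1}\times\mathrm{GL}_{\alpha_2}$ acts by base change and $G=\mathrm{GL}(W)=\mathrm{GL}_n$ acts through its natural action on the span of arrows, $(gM)(a)=M(g^{-1}a)$ ($M$ extended linearly to the span of arrows). A semi-invariant function for the tensors of size $\alpha_1\times\alpha_2\times n$ is a function $f\in k[\mathrm{Rep}_\alpha(K_n)]$ that is semi-invariant for $\mathrm{GL}_\alpha\times G$, i.e. $g\cdot f=\chi(g)f$ for some character $\chi$ (so $f$ is invariant under $\mathrm{SL}(U)\times\mathrm{SL}(V)\times\mathrm{SL}(W)$). Euler form: $\langle\alpha,\beta\rangle=\alpha_1\beta_1+\alpha_2\beta_2-n\alpha_1\beta_2$. For $M,N$ of dimension $\alpha,\beta$ with $\langle\alpha,\beta\rangle=0$, take an injective resolution $0\to N\to I_0\to I_1\to0$ and set $c_N(M)=c(M,N)=\det\big(\mathrm{Hom}(M,I_0)\to\mathrm{Hom}(M,I_1)\big)$,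 well defined up to a nonzero constant; $c_N$ is viewed as a function on $\mathrm{Rep}_\alpha(K_n)$. ''General'' means: in a nonempty Zariski open subset. *)

(* Defs.v *)
From HB Require Import structures.
From mathcomp Require Import all_boot all_order all_algebra.
From mathcomp Require Import mpoly mxtens zify.

Set Implicit Arguments.
Unset Strict Implicit.
Unset Printing Implicit Defensive.
Import Order.TTheory GRing.Theory Num.Theory.
Local Open Scope ring_scope.

(** An affine space is given by a type [T] with a family of coordinate functions
    [coord : T -> I -> k] indexed by a finite type [I]. *)

Section AffineSpace.
Variables (k : fieldType) (T : Type) (I : finType) (coord : T -> I -> k).

Definition peval (p : {mpoly k[#|I|]}) (x : T) : k :=
  p.@[fun j => coord x (enum_val j)].

Definition polynomial_function (f : T -> k) : Prop :=
  exists p : {mpoly k[#|I|]}, forall x, f x = peval p x.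

Definition zariski_open (U : T -> Prop) : Prop :=
  exists S : {mpoly k[#|I|]} -> Prop,
    forall x, U x <-> exists2 p, S p & peval p x <> 0.

Definition holds_generally (P : T -> Prop) : Prop :=
  exists U : T -> Prop,
    [/\ zariski_open U, exists x, U x & forall x, U x -> P x].

End AffineSpace.

(** A representation of the [n]-arrow Kronecker quiver of dimension [(a1, a2)];
    [M i] is the matrix of the [i]-th arrow and acts by right multiplication on
    row vectors. *)

Definition krep (k : fieldType) (n a1 a2 : nat) : Type := 'I_n -> 'M[k]_(a1, a2).

Definition krep_coord (k : fieldType) (n a1 a2 : nat) (M : krep k n a1 a2)
  (t : 'I_n * 'I_a1 * 'I_a2) : k := M t.1.1 t.1.2 t.2.

Definition euler_form (n a1 a2 b1 b2 : nat) : int :=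
  (a1 * b1)%:Z + (a2 * b2)%:Z - (n * a1 * b2)%:Z.

Section Kronecker.
Variables (k : fieldType) (n : nat).

Definition is_hom a1 a2 b1 b2 (M : krep k n a1 a2) (N : krep k n b1 b2)
    (f1 : 'M[k]_(a1, b1)) (f2 : 'M[k]_(a2, b2)) : Prop :=
  forall i, M i *m f2 = f1 *m N i.

(** The indecomposable injectives are [I_1], of dimension [(1, 0)], and [I_2], of
    dimension [(n, 1)]; hence every injective is, up to isomorphism,
    [injrep p q], the direct sum of [p] copies of [I_1] and [q] copies of [I_2].
    The space of [I_2 ^ q] at vertex 1 is ['M_(n, q)], flattened by [mxvec], and
    the [i]-th arrow extracts the [i]-th row. *)

Definition injrep (p q : nat) : krep k n (p + n * q) q :=
  fun i => col_mx 0 (lin1_mx (fun x : 'rV[k]_(n * q) => row i (vec_mx x))).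

(** The map [x |-> (x *m M i)_i] from [k^a1] to ['M_(n, a2)], flattened. *)
Definition arrows_mx a1 a2 (M : krep k n a1 a2) : 'M[k]_(a1, n * a2) :=
  \matrix_(r < a1) mxvec (\matrix_(i < n) row r (M i)).

(** [Hom(M, I_x)] is canonically the dual of [M(x)]; hence a morphism
    [M -> injrep p q] is the same as a pair [u : 'M_(a1, p)], [v : 'M_(a2, q)].
    Its component at vertex 2 is [v], its component at vertex 1 is the following
    (see [hom_injrepP]). *)
Definition hom_inj1 a1 a2 p q (M : krep k n a1 a2)
    (u : 'M[k]_(a1, p)) (v : 'M[k]_(a2, q)) : 'M[k]_(a1, p + n * q) :=
  row_mx u (arrows_mx (fun i => M i *m v)).

(** [0 -> N -> injrep p0 q0 -> injrep p1 q1 -> 0]; the maps are [in] and [d], the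
    suffixes 1 and 2 refer to the vertices. *)
Record inj_resolution b1 b2 (N : krep k n b1 b2) := InjResolution {
  ir_p0 : nat; ir_q0 : nat; ir_p1 : nat; ir_q1 : nat;
  ir_in1 : 'M[k]_(b1, ir_p0 + n * ir_q0);
  ir_in2 : 'M[k]_(b2, ir_q0);
  ir_d1 : 'M[k]_(ir_p0 + n * ir_q0, ir_p1 + n * ir_q1);
  ir_d2 : 'M[k]_(ir_q0, ir_q1);
  ir_in_hom : is_hom N (injrep ir_p0 ir_q0) ir_in1 ir_in2;
  ir_d_hom : is_hom (injrep ir_p0 ir_q0) (injrep ir_p1 ir_q1) ir_d1 ir_d2;
  ir_mono1 : row_free ir_in1;
  ir_mono2 : row_free ir_in2;
  ir_exact1 : (ir_in1 == kermx ir_d1)%MS;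
  ir_exact2 : (ir_in2 == kermx ir_d2)%MS;
  ir_epi1 : row_full ir_d1;
  ir_epi2 : row_full ir_d2
}.

(** The matrix of [Hom(M, I0) -> Hom(M, I1)], composition with the differential,
    in the coordinates [(u, v)] of both spaces. *)
Definition hom_res_mx b1 b2 (N : krep k n b1 b2) (R : inj_resolution N)
    a1 a2 (M : krep k n a1 a2) :
    'M[k]_(a1 * ir_p0 R + a2 * ir_q0 R, a1 * ir_p1 R + a2 * ir_q1 R) :=
  lin1_mx (fun w =>
    let u := vec_mx (lsubmx w) in
    let v := vec_mx (rsubmx w) in
    row_mx (mxvec (lsubmx (hom_inj1 M u v *m ir_d1 R))) (mxvec (v *m ir_d2 R))).

(** [c_N] as a function on representations of dimension [(a1, a2)], for a given
    injective resolution of [N]. When [<(a1, a2), (b1, b2)> = 0] the matrix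
    [hom_res_mx R M] is square by [hom_res_square], so that [conform_mx] is only a
    cast to a square matrix type; otherwise the value is meaningless. *)
Definition cfun b1 b2 (N : krep k n b1 b2) (R : inj_resolution N)
    (a1 a2 : nat) (M : krep k n a1 a2) : k :=
  \det (conform_mx (0 : 'M[k]_(a1 * ir_p0 R + a2 * ir_q0 R)) (hom_res_mx R M)).

Lemma arrows_mx_eqP a1 a2 (M : krep k n a1 a2) (A : 'M[k]_(a1, n * a2)) :
  (forall r i s, vec_mx (row r A) i s = M i r s) -> A = arrows_mx M.
Proof.
move=> eqA; apply/row_matrixP => r; rewrite rowK -[LHS]vec_mxK; congr mxvec.
by apply/matrixP => i s; rewrite eqA !mxE.
Qed.

Lemma mulmx_injrep m p q (x : 'M[k]_(m, p)) (y : 'M[k]_(m, n * q)) i r s :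
  (row_mx x y *m injrep p q i) r s = vec_mx (row r y) i s.
Proof.
rewrite /injrep mul_row_col mulmx0 add0r.
rewrite -[LHS]/((y *m lin1_mx (row i \o @vec_mx k n q)) r s).
have := mul_rV_lin1 (row i \o @vec_mx k n q) (row r y).
by rewrite -row_mul => /rowP/(_ s); rewrite mxE => ->; rewrite /= mxE.
Qed.

Lemma arrows_mxK a1 a2 (M : krep k n a1 a2) r i s :
  vec_mx (row r (arrows_mx M)) i s = M i r s.
Proof. by rewrite rowK mxvecK !mxE. Qed.

Lemma hom_injrepP a1 a2 p q (M : krep k n a1 a2)
    (f1 : 'M[k]_(a1, p + n * q)) (f2 : 'M[k]_(a2, q)) :
  is_hom M (injrep p q) f1 f2 <-> exists u, f1 = hom_inj1 M u f2.
Proof.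
split=> [homf | [u ->] i]; last first.
  by apply/matrixP => r s; rewrite mulmx_injrep arrows_mxK.
exists (lsubmx f1); rewrite -[LHS]hsubmxK /hom_inj1; congr row_mx.
apply: arrows_mx_eqP => r i s; rewrite homf -{2}[f1]hsubmxK.
by rewrite mulmx_injrep.
Qed.

Lemma injrep_injective p q a1 a2 b1 b2 (L : krep k n a1 a2) (M : krep k n b1 b2)
    j1 j2 f1 f2 :
  is_hom L M j1 j2 -> row_free j1 -> row_free j2 ->
  is_hom L (injrep p q) f1 f2 ->
  exists g1 g2, [/\ is_hom M (injrep p q) g1 g2, j1 *m g1 = f1 & j2 *m g2 = f2].
Proof.
move=> homj fj1 fj2 /hom_injrepP[u ->].
have j1K : j1 *m pinvmx j1 = 1%:M by exact: mulmxVp.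
have j2K : j2 *m pinvmx j2 = 1%:M by exact: mulmxVp.
exists (hom_inj1 M (pinvmx j1 *m u) (pinvmx j2 *m f2)), (pinvmx j2 *m f2).
split; last by rewrite mulmxA j2K mul1mx.
  by apply/hom_injrepP; exists (pinvmx j1 *m u).
rewrite /hom_inj1 mul_mx_row mulmxA j1K mul1mx; congr row_mx.
apply: arrows_mx_eqP => r i s.
have -> : L i *m f2 = j1 *m (M i *m (pinvmx j2 *m f2)).
  by rewrite [RHS]mulmxA -homj -mulmxA (mulmxA j2) j2K mul1mx.
rewrite row_mul mxE [LHS]mxE [RHS]mxE; apply: eq_bigr => t _.
rewrite mxE; congr (_ * _).
by rewrite -(arrows_mxK (fun i0 => M i0 *m _) t i s) [RHS]mxE [RHS]mxE.
Qed.

(** [0 -> N -> (+)_x I_x (x) N(x) -> (+)_a I_1 (x) N(2) -> 0], with [a] over the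
    arrows. *)
Definition std_resolution b1 b2 (N : krep k n b1 b2) : inj_resolution N.
Proof.
have jE : hom_inj1 N 1%:M 1%:M = row_mx 1%:M (arrows_mx N).
  rewrite /hom_inj1; congr row_mx.
  by apply: arrows_mx_eqP => r i s; rewrite arrows_mxK mulmx1.
pose d1 := row_mx (col_mx (- arrows_mx N) 1%:M) 0 :
  'M[k]_(b1 + n * b2, n * b2 + n * 0).
refine (@InjResolution b1 b2 N b1 b2 (n * b2) 0
  (hom_inj1 N 1%:M 1%:M) 1%:M d1 0 _ _ _ _ _ _ _ _).
- by apply/hom_injrepP; exists 1%:M.
- by move=> i; apply/matrixP => r [].
- apply/row_freeP; exists (col_mx 1%:M 0).
  by rewrite jE mul_row_col mulmx0 addr0 mulmx1.
- by rewrite row_free_unit unitmx1.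
- apply/andP; split.
    apply/sub_kermxP; rewrite jE mul_mx_row mulmx0 mul_row_col mul1mx mulmx1.
    by rewrite addNr row_mx0.
  have := mulmx_ker d1; rewrite -[kermx d1]hsubmxK mul_mx_row mulmx0.
  rewrite -[0 in RHS]row_mx0 => /eq_row_mx[+ _].
  rewrite mul_row_col mulmxN mulmx1 addrC => /subr0_eq ->.
  by rewrite -{1}[lsubmx _]mulmx1 -mul_mx_row -jE submxMl.
- by apply/andP; split; [apply/sub_kermxP; rewrite mulmx0 | apply: submx1].
- apply/row_fullP; exists (col_mx (row_mx 0 1%:M) (0 : 'M_(n * 0, _))).
  rewrite mul_mx_row mulmx0 mul_col_mx mul_row_col mul0mx add0r mulmx1 mul0mx.
  rewrite scalar_mx_block block_mxEh; congr row_mx; rewrite -[LHS]col_mx0.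
  congr col_mx; by apply/matrixP => r; have := ltn_ord r; rewrite {2}muln0.
- by rewrite /row_full mxrank0.
Defined.

Lemma mul_hom_res_mx b1 b2 (N : krep k n b1 b2) (R : inj_resolution N)
    a1 a2 (M : krep k n a1 a2) u v :
  row_mx (mxvec u) (mxvec v) *m hom_res_mx R M =
  row_mx (mxvec (lsubmx (hom_inj1 M u v *m ir_d1 R))) (mxvec (v *m ir_d2 R)).
Proof.
rewrite /hom_res_mx; set f := (F in lin1_mx F).
have hom_inj1_lin c u1 v1 u2 v2 : hom_inj1 M (c *: u1 + u2) (c *: v1 + v2)
    = c *: hom_inj1 M u1 v1 + hom_inj1 M u2 v2
      :> 'M_(a1, ir_p0 R + n * ir_q0 R).
  rewrite scale_row_mx add_row_mx; congr row_mx; apply/esym.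
  apply: arrows_mx_eqP => r i s.
  rewrite !linearP /= mxE [X in X + _]mxE !arrows_mxK.
  by rewrite [RHS]mxE [in RHS]mxE.
have f_lin : linear f.
  move=> c w1 w2; rewrite /f !linearP /= hom_inj1_lin mulmxDl -scalemxAl.
  by rewrite mulmxDl -scalemxAl !linearP /= scale_row_mx add_row_mx.
pose F : {linear _ -> _} := HB.pack f (GRing.isLinear.Build _ _ _ _ f f_lin).
by rewrite (mul_rV_lin1 F) /= /f row_mxKl row_mxKr !mxvecK.
Qed.

Lemma hom_res_square b1 b2 (N : krep k n b1 b2) (R : inj_resolution N) a1 a2 :
  euler_form n a1 a2 b1 b2 = 0 ->
  (a1 * ir_p0 R + a2 * ir_q0 R = a1 * ir_p1 R + a2 * ir_q1 R)%N.
Proof.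
case: R => p0 q0 p1 q1 j1 j2 d1 d2 _ _ /eqP rj1 /eqP rj2 ex1 ex2 /eqP rd1 /eqP rd2 /=.
have e1 : (b1 + (p1 + n * q1) = p0 + n * q0)%N.
  by rewrite -rj1 -rd1 (eqmx_rank ex1) mxrank_ker subnK // rank_leq_row.
have e2 : (b2 + q1 = q0)%N.
  by rewrite -rj2 -rd2 (eqmx_rank ex2) mxrank_ker subnK // rank_leq_row.
rewrite /euler_form => /eqP; rewrite subr_eq0 -PoszD => /eqP[eu].
subst q0; apply/eqP; rewrite -(eqn_add2r (n * a1 * b2)) -{1}eu.
apply/eqP; nia.
Qed.

End Kronecker.
Section SemiInvariants.
Variables (k : fieldType) (n a1 a2 : nat).

(** An element of the group is a triple satisfying [in_GL]. *)
Definition mx_triple : Type := 'M[k]_a1 * 'M[k]_a2 * 'M[k]_n.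

Definition in_GL (g : mx_triple) : Prop :=
  [/\ g.1.1 \in unitmx, g.1.2 \in unitmx & g.2 \in unitmx].

Definition GL_mul (g h : mx_triple) : mx_triple :=
  (g.1.1 *m h.1.1, g.1.2 *m h.1.2, g.2 *m h.2).

Definition GL_inv (g : mx_triple) : mx_triple :=
  (invmx g.1.1, invmx g.1.2, invmx g.2).

Definition triple_coord (g : mx_triple)
    (t : 'I_a1 * 'I_a1 + 'I_a2 * 'I_a2 + 'I_n * 'I_n) : k :=
  match t with
  | inl (inl (i, j)) => g.1.1 i j
  | inl (inr (i, j)) => g.1.2 i j
  | inr (i, j) => g.2 i j
  end.

(** [M] extended linearly to the span ['cV_n] of the arrows; the [i]-th arrow is
    [delta_mx i 0]. *)
Definition arrow_ext (M : krep k n a1 a2) (w : 'cV[k]_n) : 'M[k]_(a1, a2) :=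
  \sum_i w i 0 *: M i.

(** Base change by [(g.1.1, g.1.2)] on row vectors, where [x] is sent to
    [x *m invmx g.1.1] (resp. [x *m invmx g.1.2]), together with
    [(g M)(a) = M(g^-1 a)] for [g.2]. *)
Definition GL_act (g : mx_triple) (M : krep k n a1 a2) : krep k n a1 a2 :=
  fun i => g.1.1 *m arrow_ext M (invmx g.2 *m delta_mx i 0) *m invmx g.1.2.

(** Characters of the algebraic group. A regular function on it is a polynomial
    in the entries divided by a power of the determinants. *)
Definition is_character (chi : mx_triple -> k) : Prop :=
  [/\ forall g, in_GL g -> chi g != 0,
      forall g h, in_GL g -> in_GL h -> chi (GL_mul g h) = chi g * chi h
    & exists (F : mx_triple -> k) (m : nat),
        polynomial_function triple_coord F /\
        forall g, in_GL g ->
          chi g = F g / (\det g.1.1 * \det g.1.2 * \det g.2) ^+ m].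

Definition semi_invariant (f : krep k n a1 a2 -> k) : Prop :=
  polynomial_function (@krep_coord k n a1 a2) f /\
  exists2 chi, is_character chi &
    forall g, in_GL g -> forall M, f (GL_act (GL_inv g) M) = chi g * f M.

End SemiInvariants.

(** [X *t B] is the block matrix with [(p, q)] block [X p q *: B]. *)

Section Blocks.
Variables (k : fieldType) (b : nat).

(** Indices start from 1. *)
Definition E (m n p q : nat) : 'M[k]_(m, n) :=
  \matrix_(i, j) ((i.+1 == p) && (j.+1 == q))%:R.

Definition krep3 (m n : nat) (A1 A2 A3 : 'M[k]_(m, n)) : krep k 3 m n :=
  fun i => nth 0 [:: A1; A2; A3] i.

Definition Au (B1 : 'M[k]_b) : krep k 3 (1 * b) (3 * b) :=
  let E := E 1 3 in
  krep3 (E 1 3 *t B1) (E 1 2 *t B1) (E 1 1 *t B1).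

Definition Al (B2 : 'M[k]_b) : krep k 3 (8 * b) (3 * b) :=
  let E := E 8 3 in
  krep3
    ((- 2 *: E 1 1 + 2 *: E 3 2 - E 7 3) *t B2)
    ((2 *: E 2 1 + 2 *: E 4 3 + E 7 2 - E 8 2) *t B2)
    ((2 *: E 5 2 + 2 *: E 6 3 + E 8 1) *t B2).

Definition Ar (B3 : 'M[k]_b) : krep k 3 (8 * b) (6 * b) :=
  let E := E 8 6 in
  krep3
    ((E 1 1 - 2 *: E 2 5 + E 3 2 + 2 *: E 5 6 + 2^-1 *: E 7 3 - E 8 3) *t B3)
    ((- 2 *: E 1 4 + E 2 1 - E 4 3 - 2 *: E 6 6 + 2^-1 *: E 7 2
      + 2^-1 *: E 8 2) *t B3)
    ((- 2 *: E 3 4 + 2 *: E 4 5 - E 5 2 + E 6 3 - E 7 1 + 2^-1 *: E 8 1) *t B3).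

Definition Ad (B4 : 'M[k]_b) : krep k 3 (10 * b) (6 * b) :=
  let E := E 10 6 in
  krep3
    ((3 *: E 1 4 + E 4 1 + E 5 5 + E 6 2 + 2^-1 *: E 8 6 + 8^-1 *: E 10 3) *t B4)
    ((3 *: E 2 5 + E 4 4 + E 5 1 + 2^-1 *: E 7 3 + 4^-1 *: E 9 6
      + 8^-1 *: E 10 2) *t B4)
    ((3 *: E 3 6 + E 6 4 + 2^-1 *: E 7 5 + 2^-1 *: E 8 2 + 4^-1 *: E 9 3
      + 8^-1 *: E 10 1) *t B4).

Definition N1 (B3 : 'M[k]_b) : krep k 3 (8 * b) (6 * b) := Ar B3.

Definition N2 (B4 : 'M[k]_b) : krep k 3 (10 * b) (6 * b) := Ad B4.

Definition N3 (B2 B3 : 'M[k]_b) : krep k 3 (8 * b) (3 * b + 6 * b) :=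
  fun i => row_mx (Al B2 i) (Ar B3 i).

Definition N4 (B2 B3 B4 : 'M[k]_b) :
    krep k 3 (8 * b + 10 * b) (3 * b + 6 * b) :=
  fun i => block_mx (Al B2 i) (Ar B3 i) 0 (Ad B4 i).

Definition N5 (B1 B2 B3 B4 : 'M[k]_b) :
    krep k 3 (1 * b + (8 * b + 10 * b)) (3 * b + 6 * b) :=
  fun i => col_mx (row_mx (Au B1 i) 0)
                  (block_mx (Al B2 i) (Ar B3 i) 0 (Ad B4 i)).

End Blocks.

Definition quad (k : fieldType) (b : nat) : Type :=
  'M[k]_b * 'M[k]_b * 'M[k]_b * 'M[k]_b.

Definition quad_coord (k : fieldType) (b : nat) (B : quad k b)
    (t : 'I_4 * ('I_b * 'I_b)) : k :=
  let: (B1, B2, B3, B4) := B in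
  nth 0 [:: B1; B2; B3; B4] t.1 t.2.1 t.2.2.

Lemma euler_form_N a b :
  [/\ euler_form 3 (3 * a) (5 * a) (8 * b) (6 * b) = 0,
      euler_form 3 (3 * a) (4 * a) (10 * b) (6 * b) = 0,
      euler_form 3 (9 * a) (19 * a) (8 * b) (3 * b + 6 * b) = 0,
      euler_form 3 a a (8 * b + 10 * b) (3 * b + 6 * b) = 0
    & euler_form 3 (9 * a) (8 * a)
        (1 * b + (8 * b + 10 * b)) (3 * b + 6 * b) = 0].
Proof. by rewrite /euler_form; split; nia. Qed.

(* Main.v *)
Require Import Defs.
From HB Require Import structures.
From mathcomp Require Import all_boot all_order all_algebra.
From mathcomp Require Import mpoly mxtens ring zify.
Import GRing.Theory.
Local Open Scope ring_scope.

(** Write [T_N(M)] for the map [(x, v) |-> (M_i v + x N_i)_i]. For every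
    injective resolution of [N], splitting off contractible summands shows that
    [c_N(M)] is a constant times [det T_N(M)], which is polynomial in [M] and
    semi-invariant under base change at the two vertices. It is semi-invariant
    under [GL_n] as well as soon as there are polynomial representations [rho1],
    [rho2] of [GL_n] with [rho1(g) N_i = sum_j g_ji N_j rho2(g)].

    For the representations at hand, let [W] be the standard representation of
    [GL_3]. The 6 and 3 columns index bases of [S^2 W] and [Lambda^2 W], inside
    [W (x) W], so that a row of a tuple [(A_i)_i] is a tensor in [W (x) W (x) W],
    the arrow being the first index. The rows of [Ad] are then a basis of the
    symmetric tensors, the row of [Au] spans the alternating ones, and the rows of
    [Al] are a basis of the tensors, skew in the last two indices, whose cyclic
    sum is zero; these spaces are stable under [GL_3], which yields [rho1]. The
    rows of [Ar] are the images of those of [Al] under an equivariant map. As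
    [GL_3] acts on the blocks separately, tensoring with arbitrary [B_i] changes
    nothing. *)

Set Implicit Arguments.
Unset Strict Implicit.
Unset Printing Implicit Defensive.

(** * Polynomial functions and characters *)

Section PolynomialFunctions.
Variables (k : fieldType) (T : Type) (I : finType) (coord : T -> I -> k).
Local Notation polyfun := (polynomial_function coord).

Lemma polyfun_ext (f f' : T -> k) : polyfun f -> f =1 f' -> polyfun f'.
Proof. by move=> [p Hp] ff'; exists p => x; rewrite -ff'. Qed.

Lemma polyfun_const (c : k) : polyfun (fun=> c).
Proof. by exists c%:MP => x; rewrite /peval mevalC. Qed.

Lemma polyfun_coord i : polyfun (coord^~ i).
Proof.
by exists 'X_(enum_rank i) => x; rewrite /peval mevalXU enum_rankK.
Qed.

Lemma polyfunD f f' : polyfun f -> polyfun f' -> polyfun (fun x => f x + f' x).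
Proof.
by move=> [p Hp] [p' Hp']; exists (p + p') => x; rewrite /peval mevalD Hp Hp'.
Qed.

Lemma polyfunM f f' : polyfun f -> polyfun f' -> polyfun (fun x => f x * f' x).
Proof.
by move=> [p Hp] [p' Hp']; exists (p * p') => x; rewrite /peval mevalM Hp Hp'.
Qed.

Lemma polyfunX f m : polyfun f -> polyfun (fun x => f x ^+ m).
Proof.
by move=> [p Hp]; exists (p ^+ m) => x; rewrite Hp /peval rmorphXn.
Qed.

Lemma polyfun_sum (J : Type) (r : seq J) (P : pred J) (F : J -> T -> k) :
  (forall j, polyfun (F j)) -> polyfun (fun x => \sum_(j <- r | P j) F j x).
Proof.
move=> pF; elim: r => [|j r IHr].
  by apply: (polyfun_ext (polyfun_const 0)) => x; rewrite big_nil.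
apply: (@polyfun_ext (fun x =>
    (if P j then F j x else 0) + \sum_(j0 <- r | P j0) F j0 x)); last first.
  by move=> x; rewrite big_cons; case: ifP; rewrite ?add0r.
by apply: polyfunD => //; case: (P j); [apply: pF | apply: polyfun_const].
Qed.

Lemma polyfun_prod (J : Type) (r : seq J) (P : pred J) (F : J -> T -> k) :
  (forall j, polyfun (F j)) -> polyfun (fun x => \prod_(j <- r | P j) F j x).
Proof.
move=> pF; elim: r => [|j r IHr].
  by apply: (polyfun_ext (polyfun_const 1)) => x; rewrite big_nil.
apply: (@polyfun_ext (fun x =>
    (if P j then F j x else 1) * \prod_(j0 <- r | P j0) F j0 x)); last first.
  by move=> x; rewrite big_cons; case: ifP; rewrite ?mul1r.
by apply: polyfunM => //; case: (P j); [apply: pF | apply: polyfun_const].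
Qed.

Definition polymx m n (A : T -> 'M[k]_(m, n)) :=
  forall i j, polyfun (fun x => A x i j).

Lemma polymx_const m n (A : 'M[k]_(m, n)) : polymx (fun=> A).
Proof. by move=> i j; apply: polyfun_const. Qed.

Lemma polymxM m n p (A : T -> 'M[k]_(m, n)) (B : T -> 'M[k]_(n, p)) :
  polymx A -> polymx B -> polymx (fun x => A x *m B x).
Proof.
move=> pA pB i j.
apply: (@polyfun_ext (fun x => \sum_l A x i l * B x l j)); last first.
  by move=> x; rewrite mxE.
by apply: polyfun_sum => l; apply: polyfunM.
Qed.

Lemma polymx_tr m n (A : T -> 'M[k]_(m, n)) :
  polymx A -> polymx (fun x => (A x)^T).
Proof. by move=> pA i j; apply: (polyfun_ext (pA j i)) => x; rewrite mxE. Qed.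

Lemma polymx_col m1 m2 n (A : T -> 'M[k]_(m1, n)) (B : T -> 'M[k]_(m2, n)) :
  polymx A -> polymx B -> polymx (fun x => col_mx (A x) (B x)).
Proof.
move=> pA pB i j; case: (split_ordP i) => i' ->.
  by apply: (polyfun_ext (pA i' j)) => x; rewrite col_mxEu.
by apply: (polyfun_ext (pB i' j)) => x; rewrite col_mxEd.
Qed.

Lemma polymx_block_diag m1 m2 (A : T -> 'M[k]_m1) (B : T -> 'M[k]_m2) :
  polymx A -> polymx B -> polymx (fun x => block_mx (A x) 0 0 (B x)).
Proof.
move=> pA pB i j; case: (split_ordP i) => i' ->; case: (split_ordP j) => j' ->.
- by apply: (polyfun_ext (pA i' j')) => x; rewrite block_mxEul.
- by apply: (polyfun_ext (polyfun_const 0)) => x; rewrite block_mxEur mxE.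
- by apply: (polyfun_ext (polyfun_const 0)) => x; rewrite block_mxEdl mxE.
- by apply: (polyfun_ext (pB i' j')) => x; rewrite block_mxEdr.
Qed.

Lemma polymx_tens1 m b (A : T -> 'M[k]_m) :
  polymx A -> polymx (fun x => A x *t (1%:M : 'M_b)).
Proof.
move=> pA i j.
pose c := (1%:M : 'M[k]_b) (mxtens_unindex i).2 (mxtens_unindex j).2.
apply: (polyfun_ext (polyfunM
  (pA (mxtens_unindex i).1 (mxtens_unindex j).1) (polyfun_const c))) => x.
by rewrite /tensmx mxE.
Qed.

Lemma polymx_lin m n m' n' (A : T -> {linear 'M[k]_(m, n) -> 'M_(m', n')}) :
  (forall v, polymx (fun x => A x v)) -> polymx (fun x => lin_mx (A x)).
Proof.
move=> pA i j; case/mxvec_indexP: j => u v.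
apply: (polyfun_ext (pA (vec_mx (delta_mx 0 i)) u v)) => x.
by rewrite -[RHS]mul1r /lin_mx mxE [X in _ = _ * X]mxvecE /= mul1r.
Qed.

Lemma polyfun_det n (A : T -> 'M[k]_n) :
  polymx A -> polyfun (fun x => \det (A x)).
Proof.
move=> pA; apply: polyfun_sum => s; apply: polyfunM (polyfun_const _) _.
exact: polyfun_prod.
Qed.

Lemma polymx_adj n (A : T -> 'M[k]_n) :
  polymx A -> polymx (fun x => \adj (A x)).
Proof.
move=> pA i j; apply: (@polyfun_ext (fun x => cofactor (A x) j i)); last first.
  by move=> x; rewrite mxE.
apply: polyfunM (polyfun_const _) _; apply: polyfun_det => s t.
by apply: (polyfun_ext (pA (lift j s) (lift i t))) => x; rewrite !mxE.
Qed.

End PolynomialFunctions.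

Section Composition.
Variables (k : fieldType) (T : Type) (I : finType) (coord : T -> I -> k).
Variables (T' : Type) (I' : finType) (coord' : T' -> I' -> k) (phi : T -> T').

Lemma polyfun_comp (f : T' -> k) :
  polynomial_function coord' f ->
  (forall i, polynomial_function coord (fun x => coord' (phi x) i)) ->
  polynomial_function coord (f \o phi).
Proof.
move=> [p Hp] pphi.
apply: (@polyfun_ext _ _ _ _ (fun x => \sum_(m <- msupp p)
   p@_m * \prod_i coord' (phi x) (enum_val i) ^+ m i)); last first.
  by move=> x; rewrite /= Hp /peval mevalE.
apply: polyfun_sum => m; apply: polyfunM (polyfun_const _ _) _.
by apply: polyfun_prod => i; apply: polyfunX.
Qed.

End Composition.

Definition mx_coord (k : fieldType) m n (A : 'M[k]_(m, n)) (t : 'I_m * 'I_n) : k :=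
  A t.1 t.2.

(** * Characters of the group from polynomial characters of one factor *)

Section PolynomialCharacters.
Variable k : fieldType.

(** By the last condition [delta (\adj g)] is, up to a power of [\det g], the
    inverse of [delta g]; this makes the inverse of [delta] regular. *)
Definition poly_char n d (delta : 'M[k]_n -> k) : Prop :=
  [/\ polynomial_function (@mx_coord k n n) delta,
      {morph delta : g h / g *m h >-> g * h}
    & forall c, delta c%:M = c ^+ d].

Lemma poly_char_adj n d (delta : 'M[k]_n -> k) g :
  poly_char d delta -> delta g * delta (\adj g) = \det g ^+ d.
Proof. by move=> [_ dM dC]; rewrite -dM mul_mx_adj dC. Qed.

Lemma poly_char_neq0 n d (delta : 'M[k]_n -> k) g :
  poly_char d delta -> g \in unitmx -> delta g != 0.
Proof.
move=> dP ug; have : \det g ^+ d != 0 by rewrite expf_neq0 // -unitfE.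
by rewrite -(poly_char_adj g dP) mulf_eq0 => /norP[].
Qed.

Lemma poly_charV n d (delta : 'M[k]_n -> k) g :
  poly_char d delta -> g \in unitmx -> delta (invmx g) = (delta g)^-1.
Proof.
move=> dP ug; have [_ dM dC] := dP; apply: (mulfI (poly_char_neq0 dP ug)).
by rewrite divff ?(poly_char_neq0 dP) // -dM mulmxV // dC expr1n.
Qed.

Variables n a1 a2 : nat.
Local Notation triple := (mx_triple k n a1 a2).
Local Notation coord := (@triple_coord k n a1 a2).
Local Notation det3 g := (\det g.1.1 * \det g.1.2 * \det g.2).

Lemma is_characterM (chi psi : triple -> k) :
  is_character chi -> is_character psi -> is_character (fun g => chi g * psi g).
Proof.
move=> [c0 cM [F [m [pF cF]]]] [p0 pM [F' [m' [pF' cF']]]]; split.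
- by move=> g gG; rewrite mulf_neq0 ?c0 ?p0.
- by move=> g h gG hG; rewrite cM // pM // mulrACA.
- exists (fun g => F g * F' g), (m + m')%N; split; first exact: polyfunM.
  by move=> g gG; rewrite cF // cF' // exprD invfM mulrACA.
Qed.

Section Pullback.
Variables (m d : nat) (delta : 'M[k]_m -> k) (dP : poly_char d delta).
Variables (pr : triple -> 'M[k]_m) (codet : triple -> k).
Hypotheses (pr_poly : polymx coord pr) (codet_poly : polynomial_function coord codet).
Hypothesis prM : forall g h, pr (GL_mul g h) = pr g *m pr h.
Hypothesis pr_unit : forall g, in_GL g -> pr g \in unitmx.
Hypothesis codetE : forall g, \det (pr g) * codet g = det3 g.

Lemma is_character_pullback : is_character (fun g => delta (pr g)).
Proof.
have [pd dM _] := dP; split.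
- by move=> g /pr_unit/(poly_char_neq0 dP).
- by move=> g h _ _; rewrite prM dM.
- exists (fun g => delta (pr g)), 0%N; split; last by move=> g; rewrite divr1.
  by apply: (polyfun_comp (phi := pr) pd) => -[i j]; apply: pr_poly.
Qed.

(** By [poly_char_adj] the inverse of [delta (pr g)] is [delta (\adj (pr g))] over
    [\det (pr g) ^+ d]; the factor [codet g ^+ d] then turns the denominator into the power of all
    three determinants that [is_character] asks for. *)
Lemma is_character_pullbackV : is_character (fun g => (delta (pr g))^-1).
Proof.
have [pd dM _] := dP; split.
- by move=> g /pr_unit/(poly_char_neq0 dP); rewrite invr_eq0.
- by move=> g h _ _; rewrite prM dM invfM.
- exists (fun g => delta (\adj (pr g)) * codet g ^+ d), d; split.
    apply: polyfunM; last exact: polyfunX.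
    apply: (polyfun_comp (phi := fun g => \adj (pr g)) pd) => -[i j].
    exact: (polymx_adj pr_poly).
  move=> g gG; have nz := poly_char_neq0 dP (pr_unit gG).
  have := gG; rewrite /in_GL !unitmxE !unitfE => -[n1 n2 n3].
  have det3_neq0 : det3 g ^+ d != 0 by rewrite expf_neq0 // !mulf_neq0.
  apply: (mulIf det3_neq0); rewrite mulfVK // -codetE exprMn.
  by rewrite -(poly_char_adj _ dP) -mulrA mulKf.
Qed.

End Pullback.

Let polymx1 : polymx coord (fun g : triple => g.1.1).
Proof. by move=> i j; apply: polyfun_coord (inl (inl (i, j))). Qed.
Let polymx2 : polymx coord (fun g : triple => g.1.2).
Proof. by move=> i j; apply: polyfun_coord (inl (inr (i, j))). Qed.
Let polymx3 : polymx coord (fun g : triple => g.2).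
Proof. by move=> i j; apply: polyfun_coord (inr (i, j)). Qed.

Lemma is_character_fst d (delta : 'M[k]_a1 -> k) : poly_char d delta ->
  is_character (fun g : triple => delta g.1.1) /\
  is_character (fun g : triple => (delta g.1.1)^-1).
Proof.
move=> dP; split.
  by apply: (is_character_pullback dP) => // g [].
apply: (is_character_pullbackV dP (codet := fun g => \det g.1.2 * \det g.2)) => //.
- by apply: polyfunM; apply: polyfun_det.
- by move=> g [].
- by move=> g; rewrite mulrA.
Qed.

Lemma is_character_snd d (delta : 'M[k]_a2 -> k) : poly_char d delta ->
  is_character (fun g : triple => delta g.1.2) /\
  is_character (fun g : triple => (delta g.1.2)^-1).
Proof.
move=> dP; split.
  by apply: (is_character_pullback dP) => // g [].
apply: (is_character_pullbackV dP (codet := fun g => \det g.1.1 * \det g.2)) => //.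
- by apply: polyfunM; apply: polyfun_det.
- by move=> g [].
- by move=> g; rewrite mulrCA mulrA.
Qed.

Lemma is_character_trd d (delta : 'M[k]_n -> k) : poly_char d delta ->
  is_character (fun g : triple => delta g.2) /\
  is_character (fun g : triple => (delta g.2)^-1).
Proof.
move=> dP; split.
  by apply: (is_character_pullback dP) => // g [].
apply: (is_character_pullbackV dP (codet := fun g => \det g.1.1 * \det g.1.2)) => //.
- by apply: polyfunM; apply: polyfun_det.
- by move=> g [].
- by move=> g; rewrite mulrC.
Qed.

End PolynomialCharacters.

(** * Independence of the injective resolution *)

Section SquareDet.
Variable k : fieldType.

(** The junk value [\det 0] when [m <> n]. *)
Definition sqdet m n (A : 'M[k]_(m, n)) : k := \det (conform_mx (0 : 'M_m) A).

Lemma sqdetE n (A : 'M[k]_n) : sqdet A = \det A.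
Proof. by rewrite /sqdet conform_mx_id. Qed.

Lemma sqdetM m n p (A : 'M[k]_(m, n)) (B : 'M[k]_(n, p)) :
  m = n -> n = p -> sqdet (A *m B) = sqdet A * sqdet B.
Proof. by move=> eq_mn eq_np; subst n p; rewrite !sqdetE det_mulmx. Qed.

Lemma sqdet_lblock m1 m2 n1 n2 (A : 'M[k]_(m1, n1)) (C : 'M[k]_(m2, n1))
    (D : 'M[k]_(m2, n2)) :
  m1 = n1 -> m2 = n2 -> sqdet (block_mx A 0 C D) = sqdet A * sqdet D.
Proof. by move=> e1 e2; subst n1 n2; rewrite !sqdetE det_lblock. Qed.

Lemma polyfun_sqdet (T : Type) (I : finType) (coord : T -> I -> k) m n
    (A : T -> 'M[k]_(m, n)) :
  m = n -> polymx coord A -> polynomial_function coord (fun x => sqdet (A x)).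
Proof.
move=> eq_mn; subst n => pA; apply: (polyfun_ext (polyfun_det pA)) => x.
by rewrite sqdetE.
Qed.

End SquareDet.

(** * Matrices of left and right multiplication *)

Section LinMx.
Variable k : fieldType.

Lemma eq_mx_mxvec m n p (A B : 'M[k]_(m * n, p)) :
  (forall u, mxvec u *m A = mxvec u *m B) -> A = B.
Proof.
by move=> eqAB; apply/row_matrixP => i; rewrite !rowE -[delta_mx 0 i]vec_mxK.
Qed.

Lemma eq_mx_mxvec2 m1 n1 m2 n2 p (A B : 'M[k]_(m1 * n1 + m2 * n2, p)) :
  (forall u v, row_mx (mxvec u) (mxvec v) *m A = row_mx (mxvec u) (mxvec v) *m B) ->
  A = B.
Proof.
move=> eqAB; apply/row_matrixP => i; rewrite !rowE.
by rewrite -[delta_mx 0 i]hsubmxK -[lsubmx _]vec_mxK -[rsubmx _]vec_mxK.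
Qed.

Lemma mul_lin_mulmxr m n p (A : 'M[k]_(n, p)) (u : 'M[k]_(m, n)) :
  mxvec u *m lin_mulmxr A = mxvec (u *m A).
Proof. by rewrite /lin_mulmxr mul_vec_lin. Qed.

Lemma mul_lin_mulmx m n p (A : 'M[k]_(m, n)) (u : 'M[k]_(n, p)) :
  mxvec u *m lin_mulmx A = mxvec (A *m u).
Proof. by rewrite /lin_mulmx mul_vec_lin. Qed.

Lemma lin_mulmxrM m n p q (A : 'M[k]_(n, p)) (B : 'M[k]_(p, q)) :
  lin_mulmxr (A *m B) = lin_mulmxr A *m lin_mulmxr B :> 'M_(m * n, m * q).
Proof.
by apply: eq_mx_mxvec => u; rewrite mulmxA !mul_lin_mulmxr mulmxA.
Qed.

Lemma lin_mulmxrD m n p (A B : 'M[k]_(n, p)) :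
  lin_mulmxr (A + B) = lin_mulmxr A + lin_mulmxr B :> 'M_(m * n, m * p).
Proof. exact: linearD. Qed.

Lemma lin_mulmxr_scalar m n c : lin_mulmxr c%:M = c%:M :> 'M[k]_(m * n).
Proof.
apply: eq_mx_mxvec => u.
by rewrite mul_lin_mulmxr !mul_mx_scalar linearZ.
Qed.

Lemma lin_mulmxM m n p q (A : 'M[k]_(m, n)) (B : 'M[k]_(n, p)) :
  lin_mulmx (A *m B) = lin_mulmx B *m lin_mulmx A :> 'M_(p * q, m * q).
Proof.
by apply: eq_mx_mxvec => u; rewrite mulmxA !mul_lin_mulmx mulmxA.
Qed.

Lemma lin_mulmx_scalar m n c : lin_mulmx c%:M = c%:M :> 'M[k]_(m * n).
Proof.
apply: eq_mx_mxvec => u.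
by rewrite mul_lin_mulmx mul_mx_scalar mul_scalar_mx linearZ.
Qed.

End LinMx.

Section Kronecker.
Variables (k : fieldType) (n : nat).

Lemma eq_arrows_mx a b (M M' : krep k n a b) : M =1 M' -> arrows_mx M = arrows_mx M'.
Proof.
by move=> eqM; apply: arrows_mx_eqP => r i s; rewrite arrows_mxK eqM.
Qed.

Lemma arrows_mx_mulr a b c (M : krep k n a b) (X : 'M[k]_(b, c)) :
  arrows_mx (fun i => M i *m X) = arrows_mx M *m lin_mulmxr X.
Proof.
apply/row_matrixP => r; rewrite row_mul !rowK mul_lin_mulmxr; congr mxvec.
by apply/row_matrixP => i; rewrite row_mul !rowK row_mul.
Qed.

Lemma arrows_mx_mull a b c (M : krep k n a b) (X : 'M[k]_(c, a)) :
  arrows_mx (fun i => X *m M i) = X *m arrows_mx M.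
Proof.
apply: esym; apply: arrows_mx_eqP => r i s; rewrite row_mul mxE [LHS]mxE [RHS]mxE.
apply: eq_bigr => t _; rewrite mxE -(arrows_mxK M t i s).
by rewrite [X in _ = _ * X]mxE [X in _ = _ * X]mxE.
Qed.

Section HomsMx.
Variables (a1 a2 q : nat) (M : krep k n a1 a2).

Definition arrows_of_hom (v : 'M[k]_(a2, q)) := arrows_mx (fun i => M i *m v).

Fact arrows_of_hom_is_linear : linear arrows_of_hom.
Proof.
move=> c u v; rewrite /arrows_of_hom; apply: esym.
apply: arrows_mx_eqP => r i s.
rewrite !linearP /= mxE [X in X + _]mxE !arrows_mxK.
by rewrite [RHS]mxE [in RHS]mxE.
Qed.

HB.instance Definition _ := GRing.isLinear.Build k _ _ _ arrows_of_hom
  arrows_of_hom_is_linear.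

Definition homs_mx : 'M[k]_(a2 * q, a1 * (n * q)) := lin_mx arrows_of_hom.

Lemma mul_homs_mx v : mxvec v *m homs_mx = mxvec (arrows_of_hom v).
Proof. exact: mul_vec_lin. Qed.

End HomsMx.

(** Naturality in the multiplicity space: the inner [lin_mulmxr] applies [X] to each arrow
    component, the outer one does so in each row. *)
Lemma homs_mx_mulr a1 a2 q q' (M : krep k n a1 a2) (X : 'M[k]_(q, q')) :
  homs_mx q M *m lin_mulmxr (lin_mulmxr X) = lin_mulmxr X *m homs_mx q' M.
Proof.
apply: eq_mx_mxvec => v; rewrite !mulmxA mul_homs_mx !mul_lin_mulmxr mul_homs_mx.
rewrite /arrows_of_hom -arrows_mx_mulr; congr mxvec.
by apply: eq_arrows_mx => i; rewrite mulmxA.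
Qed.

Lemma arrows_mx_injrep p q :
  arrows_mx (@injrep k n p q) = col_mx 0 1%:M :> 'M[k]_(p + n * q, n * q).
Proof.
apply: esym; apply: arrows_mx_eqP => r i s.
by rewrite -(mulmx_injrep (col_mx 1%:M 0)) -block_mxEh -scalar_mx_block mul1mx.
Qed.

(** The determinant of [(x, v) |-> (M i *m v + x *m N i)_i], which is the map
    [Hom(M, I_0) -> Hom(M, I_1)] of the standard resolution of [N] up to a sign
    on [x]. *)
Definition std_cfun b1 b2 (N : krep k n b1 b2) a1 a2 (M : krep k n a1 a2) : k :=
  sqdet (col_mx (lin_mulmxr (arrows_mx N)) (homs_mx b2 M)).

End Kronecker.

(** * Comparison of an arbitrary resolution with the standard one *)

Section Resolution.
Variables (k : fieldType) (n b1 b2 : nat) (N : krep k n b1 b2).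
Variable R : inj_resolution N.

(** The zero block reflects [Hom(I_1, I_2) = 0]; the blocks [al] and [be] are the maps into copies
    of [I_1], and between copies of [I_2] only the component at vertex 2 matters. *)
Lemma ir_d1E : exists al be,
  ir_d1 R = block_mx al 0 be (lin_mulmxr (ir_d2 R)).
Proof.
have /hom_injrepP[u ->] := ir_d_hom R.
exists (usubmx u), (dsubmx u).
rewrite /hom_inj1 arrows_mx_mulr arrows_mx_injrep mul_col_mx mul0mx mul1mx.
by rewrite block_mxEh vsubmxK.
Qed.

Lemma ir_in1E : exists io,
  ir_in1 R = row_mx io (arrows_mx N *m lin_mulmxr (ir_in2 R)).
Proof.
have /hom_injrepP[u ->] := ir_in_hom R.
by exists u; rewrite /hom_inj1 arrows_mx_mulr.
Qed.

(** The representation [M] enters only through the maps from [I_2] to [I_1], that is, through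
    [be]. *)
Lemma hom_res_mxE a1 a2 (M : krep k n a1 a2) al be :
  ir_d1 R = block_mx al 0 be (lin_mulmxr (ir_d2 R)) ->
  hom_res_mx R M = block_mx (lin_mulmxr al) 0
    (homs_mx _ M *m lin_mulmxr be) (lin_mulmxr (ir_d2 R)).
Proof.
move=> d1E; apply: eq_mx_mxvec2 => u v; rewrite mul_hom_res_mx d1E.
rewrite !mul_row_block row_mxKl !mulmx0 !add0r mulmxA !mul_lin_mulmxr.
by rewrite mul_homs_mx mul_lin_mulmxr linearD.
Qed.

Lemma ir_dims : 
  (b1 + (ir_p1 R + n * ir_q1 R) = ir_p0 R + n * ir_q0 R)%N
  /\ (b2 + ir_q1 R = ir_q0 R)%N.
Proof.
have /eqP rj1 := ir_mono1 R; have /eqP rj2 := ir_mono2 R.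
have /eqP rd1 := ir_epi1 R; have /eqP rd2 := ir_epi2 R.
split.
  rewrite -{1}rj1 -{1}rd1 (eqmx_rank (ir_exact1 R)).
  by rewrite mxrank_ker subnK // rank_leq_row.
rewrite -{1}rj2 -{1}rd2 (eqmx_rank (ir_exact2 R)).
by rewrite mxrank_ker subnK // rank_leq_row.
Qed.

(** Splitting [d2] reduces [hom_res_mx R M] to the block [D] of the maps
    [(u, v) |-> u *m al + (M i *m v)_i *m be'] with [v] in ['M_(a2, b2)]; the
    factors [Q] and [C] below then compare [D] with [std_cfun N M] through
    [A (x, u, v) = (u + x *m io, (M i *m v)_i + x *m arrows_mx N)]. None of the
    comparison matrices involves [M]. *)
Lemma cfun_std a1 a2 : euler_form n a1 a2 b1 b2 = 0 ->
  exists c, forall M : krep k n a1 a2, cfun R M = c * std_cfun N M.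
Proof.
move=> euler; have [al [be d1E]] := ir_d1E; have [io in1E] := ir_in1E.
have [dims1 dims2] := ir_dims.
have sq := hom_res_square R euler.
have std_sq : (a1 * b1 + a2 * b2 = a1 * (n * b2))%N.
  move: euler; rewrite /euler_form => /eqP; rewrite subr_eq0 -PoszD => /eqP[->].
  by nia.
set j := ir_in2 R in in1E *; set d2 := ir_d2 R in d1E *.
pose nu := arrows_mx N; pose be' := lin_mulmxr j *m be.
(* The sequence at vertex 2 splits: [s] is a section of [d2], and [r] the complementary retraction
   of [j]. *)
have [s sd2] : exists s, s *m d2 = 1%:M by apply/row_fullP/ir_epi2.
have [r rE] : exists r, r *m j + d2 *m s = 1%:M.
  have /submxP[r rE] : (1%:M - d2 *m s <= j)%MS.
    rewrite (eqmxP (ir_exact2 R)); apply/sub_kermxP.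
    by rewrite mulmxBl mul1mx -mulmxA sd2 mulmx1 subrr.
  by exists r; rewrite -rE subrK.
have io_al : io *m al + nu *m be' = 0.
  have /sub_kermxP : (ir_in1 R <= kermx (ir_d1 R))%MS.
    by rewrite (eqmxP (ir_exact1 R)).
  rewrite in1E d1E mul_row_block -[0 in RHS]row_mx0 => /eq_row_mx[+ _].
  by rewrite -mulmxA.
(* The pair [t1], [t2] is a retraction of the injective map with components [io] and [nu], obtained
   from that of [ir_in1 R]. *)
have [t1 [t2 tE]] : exists t1 t2, io *m t1 + nu *m t2 = 1%:M.
  have /row_freeP[t] := ir_mono1 R; rewrite in1E -[t]vsubmxK mul_row_col -mulmxA.
  by move=> tE; exists (usubmx t), (lin_mulmxr j *m dsubmx t).
(* [P] sends [(u, v)] to [(u, v *m r, v *m d2)], [Q] sends [(y, w)] to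
   [(y *m t1 + w *m t2, y *m al + w *m be')], and [C] sends [(x, u, v)] to [(x *m io + u, x, v)]. *)
pose P : 'M_(a1 * ir_p0 R + a2 * ir_q0 R,
             (a1 * ir_p0 R + a2 * b2) + a2 * ir_q1 R) :=
  block_mx (row_mx 1%:M 0) 0 (row_mx 0 (lin_mulmxr r)) (lin_mulmxr d2).
pose Q : 'M_(a1 * ir_p0 R + a1 * (n * b2), a1 * b1 + a1 * ir_p1 R) :=
  block_mx (lin_mulmxr t1) (lin_mulmxr al) (lin_mulmxr t2) (lin_mulmxr be').
pose C : 'M_(a1 * b1 + (a1 * ir_p0 R + a2 * b2),
             a1 * ir_p0 R + (a1 * b1 + a2 * b2)) :=
  block_mx (lin_mulmxr io) (row_mx 1%:M 0) (col_mx 1%:M 0) (block_mx 0 0 0 1%:M).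
exists (sqdet P * (sqdet C * sqdet Q)) => M.
pose D : 'M_(a1 * ir_p0 R + a2 * b2, a1 * ir_p1 R) :=
  col_mx (lin_mulmxr al) (homs_mx b2 M *m lin_mulmxr be').
pose A : 'M_(a1 * b1 + (a1 * ir_p0 R + a2 * b2), a1 * ir_p0 R + a1 * (n * b2)) :=
  col_mx (row_mx (lin_mulmxr io) (lin_mulmxr nu))
         (block_mx 1%:M 0 0 (homs_mx b2 M)).
have p1E : (b1 + ir_p1 R = ir_p0 R + n * b2)%N by move: dims1; rewrite -dims2; nia.
have eqD : (a1 * ir_p0 R + a2 * b2 = a1 * ir_p1 R)%N by move: sq; rewrite -dims2; nia.
have -> : cfun R M = sqdet P * sqdet D.
  rewrite -[cfun R M]/(sqdet (hom_res_mx R M)) (hom_res_mxE M d1E).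
  set H := homs_mx (ir_q0 R) M.
  (* In the split coordinates the last component is preserved, which leaves [D] as the other
     diagonal block; [r *m j + d2 *m s = 1] recovers [v] from its two parts. *)
  transitivity (sqdet (P *m
      block_mx D 0 (lin_mulmxr s *m (H *m lin_mulmxr be)) 1%:M)).
    congr sqdet; rewrite mulmx_block !mulmx0 !add0r mul0mx addr0 mulmx1.
    rewrite /D !mul_row_col mul1mx !mul0mx addr0 add0r.
    rewrite /be' lin_mulmxrM !mulmxA -(mulmxA _ (homs_mx b2 M)) homs_mx_mulr.
    rewrite mulmxA -!lin_mulmxrM -/H -!mulmxDl.
    have -> : lin_mulmxr (r *m j) + lin_mulmxr (d2 *m s) = 1%:M
        :> 'M[k]_(a2 * ir_q0 R).
      by rewrite -lin_mulmxrD rE lin_mulmxr_scalar.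
by rewrite mul1mx mulmx1.
  rewrite sqdetM; [|by rewrite -dims2; nia|by rewrite eqD].
  by rewrite [sqdet (block_mx D _ _ _)]sqdet_lblock // sqdetE det1 mulr1.
have AQ : sqdet A * sqdet Q = sqdet D.
  rewrite -sqdetM; [|nia|nia].
  (* On the summand of [x], [tE] gives the identity and [io_al] the zero block. *)
  have -> : A *m Q = block_mx 1%:M 0
      (col_mx (lin_mulmxr t1) (homs_mx b2 M *m lin_mulmxr t2)) D.
    rewrite /A /Q mul_col_mx mul_row_block mulmx_block !mul1mx !mul0mx !addr0 !add0r.
    rewrite -!lin_mulmxrM -!lin_mulmxrD tE io_al linear0 lin_mulmxr_scalar.
    by rewrite /block_mx -/D; congr col_mx; rewrite -block_mxEh.
  by rewrite [sqdet (block_mx 1%:M _ _ _)]sqdet_lblock // sqdetE det1 mul1r.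
have AC : sqdet A = sqdet C * std_cfun N M.
  have -> : A = C *m block_mx 1%:M 0 0 (col_mx (lin_mulmxr nu) (homs_mx b2 M)).
    rewrite /C mulmx_block !mulmx0 !mulmx1 !addr0 !add0r mul_row_col mul_block_col.
    rewrite !mul0mx mul1mx !add0r addr0 /A /block_mx; congr col_mx.
    by rewrite mul1mx -block_mxEh.
  rewrite sqdetM; [|nia|nia].
  by rewrite [sqdet (block_mx 1%:M _ _ _)]sqdet_lblock // sqdetE det1 mul1r.
by rewrite -AQ AC; ring.
Qed.

End Resolution.

(** * Equivariant representations of the Kronecker quiver *)

Section PolynomialRepresentations.
Variables (k : fieldType) (n : nat).

(** The condition on scalars records homogeneity of degree [d]; it makes the determinant of [rho] a
    [poly_char]. *)
Definition poly_rep m d (rho : 'M[k]_n -> 'M[k]_m) : Prop :=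
  [/\ polymx (@mx_coord k n n) rho, {morph rho : g h / g *m h}
    & forall c, rho c%:M = (c ^+ d)%:M].

Lemma poly_rep_id : poly_rep 1 id.
Proof. by split=> // i j; apply: polyfun_coord (i, j). Qed.

Lemma poly_rep_block_diag m1 m2 d (rho1 : 'M[k]_n -> 'M[k]_m1)
    (rho2 : 'M[k]_n -> 'M[k]_m2) :
  poly_rep d rho1 -> poly_rep d rho2 ->
  poly_rep d (fun g => block_mx (rho1 g) 0 0 (rho2 g)).
Proof.
move=> [p1 M1 c1] [p2 M2 c2]; split; first exact: polymx_block_diag.
  move=> g h /=.
  by rewrite mulmx_block !mul0mx !mulmx0 !addr0 add0r M1 M2.
by move=> c; rewrite c1 c2 -scalar_mx_block.
Qed.

Lemma poly_rep_tens1 m b d (rho : 'M[k]_n -> 'M[k]_m) :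
  poly_rep d rho -> poly_rep d (fun g => rho g *t (1%:M : 'M_b)).
Proof.
move=> [p M c]; split; first exact: polymx_tens1.
  by move=> g h /=; rewrite M tensmx_mul mulmx1.
move=> x; rewrite c; apply/matrixP => i j.
case: (mxtens_indexP i) => i1 i2; case: (mxtens_indexP j) => j1 j2.
by rewrite tensmxE !mxE (can_eq (@mxtens_indexK m b)) mulr_natr -mulrnA mulnb.
Qed.

(** The tensor product of the standard representation with [rho], the tuples
    [(x_i)_i] of row vectors being the matrices with rows [x_i]. *)
Definition tens_rep m (rho : 'M[k]_n -> 'M[k]_m) (g : 'M[k]_n) : 'M[k]_(n * m) :=
  lin_mulmx g^T *m lin_mulmxr (rho g).

Lemma mul_tens_rep m (rho : 'M[k]_n -> 'M[k]_m) g X :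
  mxvec X *m tens_rep rho g = mxvec (g^T *m X *m rho g).
Proof. by rewrite mulmxA mul_lin_mulmx mul_lin_mulmxr. Qed.

Lemma poly_rep_tens m d (rho : 'M[k]_n -> 'M[k]_m) :
  poly_rep d rho -> poly_rep d.+1 (tens_rep rho).
Proof.
move=> [p M c]; split.
- apply: polymxM; apply: polymx_lin => v /=.
    apply: polymxM; last exact: polymx_const.
    by apply: polymx_tr => i j; apply: polyfun_coord (i, j).
  by apply: polymxM => //; apply: polymx_const.
- move=> g h; apply: eq_mx_mxvec => X.
  by rewrite mulmxA !mul_tens_rep M trmx_mul !mulmxA.
- move=> x; apply: eq_mx_mxvec => X.
  rewrite mul_tens_rep c tr_scalar_mx mul_scalar_mx !mul_mx_scalar.
  by rewrite scalerA -exprSr linearZ.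
Qed.

Lemma poly_char_det m d (rho : 'M[k]_n -> 'M[k]_m) :
  poly_rep d rho -> poly_char (d * m) (fun g => \det (rho g)).
Proof.
move=> [p M c]; split; first exact: polyfun_det.
  by move=> g h; rewrite M det_mulmx.
by move=> x; rewrite c det_scalar exprM.
Qed.

Lemma poly_rep_lin_mulmxr a m d (rho : 'M[k]_n -> 'M[k]_m) :
  poly_rep d rho ->
  poly_rep d (fun g => lin_mulmxr (rho g) : 'M_(a * m)).
Proof.
move=> [p M c]; split.
- apply: polymx_lin => v /=.
  by apply: polymxM => //; apply: polymx_const.
- by move=> g h; rewrite M lin_mulmxrM.
- by move=> x; rewrite c lin_mulmxr_scalar.
Qed.

(** Since [lin_mulmx] reverses products it is not a [poly_rep], but its determinant is still
    multiplicative. *)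
Lemma poly_char_det_lin_mulmx m :
  poly_char (n * m) (fun g => \det (lin_mulmx g : 'M[k]_(n * m))).
Proof.
split.
- apply: polyfun_det; apply: polymx_lin => v /=.
  apply: polymxM; last exact: polymx_const.
  by move=> i j; apply: polyfun_coord (i, j).
- by move=> g h; rewrite lin_mulmxM det_mulmx mulrC.
- by move=> x; rewrite lin_mulmx_scalar det_scalar.
Qed.

End PolynomialRepresentations.

(** * Semi-invariance of [c_N] for equivariant [N] *)

Section Equivariance.
Variables (k : fieldType) (n : nat).

(** [N] is, up to the base change [(rho1 g, rho2 g)], fixed by [g]. *)
Definition equivariant b1 b2 (rho1 : 'M[k]_n -> 'M[k]_b1)
    (rho2 : 'M[k]_n -> 'M[k]_b2) (N : krep k n b1 b2) : Prop :=
  forall g i, rho1 g *m N i = \sum_j g j i *: (N j *m rho2 g).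

Lemma arrows_mx_tens_rep a b (rho : 'M[k]_n -> 'M[k]_b) (M : krep k n a b) g :
  arrows_mx M *m tens_rep rho g =
  arrows_mx (fun i => \sum_j g j i *: (M j *m rho g)).
Proof.
apply: arrows_mx_eqP => r i s; rewrite row_mul -[row r _]vec_mxK mul_tens_rep.
rewrite mxvecK -mulmxA mxE summxE; apply: eq_bigr => j _; rewrite !mxE.
by congr (_ * _); apply: eq_bigr => t _; rewrite arrows_mxK.
Qed.

(** Equivariance becomes one identity: [arrows_mx N] intertwines [rho1] with [tens_rep rho2]. *)
Lemma equivariantP b1 b2 (rho1 : 'M[k]_n -> 'M[k]_b1)
    (rho2 : 'M[k]_n -> 'M[k]_b2) (N : krep k n b1 b2) :
  equivariant rho1 rho2 N <->
  forall g, rho1 g *m arrows_mx N = arrows_mx N *m tens_rep rho2 g.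
Proof.
split=> [eqN g | eqN g i].
  by rewrite -arrows_mx_mull arrows_mx_tens_rep; apply: eq_arrows_mx => i.
apply/matrixP => r s; rewrite -(arrows_mxK (fun i => _ *m N i)) arrows_mx_mull.
by rewrite eqN arrows_mx_tens_rep arrows_mxK.
Qed.

Section SemiInvariance.
Variables (b1 b2 d1 d2 : nat) (N : krep k n b1 b2).
Variables (rho1 : 'M[k]_n -> 'M[k]_b1) (rho2 : 'M[k]_n -> 'M[k]_b2).
Hypotheses (rep1 : poly_rep d1 rho1) (rep2 : poly_rep d2 rho2).
Hypothesis eqN : equivariant rho1 rho2 N.

Lemma GL_actVE a1 a2 (g : mx_triple k n a1 a2) (M : krep k n a1 a2) i :
  in_GL g ->
  GL_act (GL_inv g) M i =
  invmx g.1.1 *m (\sum_j g.2 j i *: M j) *m g.1.2.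
Proof.
move=> [u1 u2 u3]; rewrite /GL_act /GL_inv /= !invmxK; congr (_ *m _ *m _).
by rewrite /arrow_ext; apply: eq_bigr => j _; rewrite -colE mxE.
Qed.

Lemma polyfun_std_cfun a1 a2 : (a1 * b1 + a2 * b2 = a1 * (n * b2))%N ->
  polynomial_function (@krep_coord k n a1 a2) (std_cfun N (a1 := a1) (a2 := a2)).
Proof.
move=> sq; apply: polyfun_sqdet => //; apply: polymx_col.
  exact: polymx_const.
apply: polymx_lin => v r t; case/mxvec_indexP: t => i s /=.
have pMv : polymx (@krep_coord k n a1 a2) (fun M => M i *m v).
  apply: polymxM; last exact: polymx_const.
  by move=> r' s'; apply: polyfun_coord (i, r', s').
apply: (polyfun_ext (pMv r s)) => M.
by rewrite -(arrows_mxK (fun i0 => M i0 *m v) r i s) !mxE.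
Qed.

(** The maps [T_N(M)] and [T_N(g^-1 M)] differ by automorphisms of source and target that depend on
    [g] alone. The [x] rows use the equivariance of [N]; in the [v] rows [invmx g.1.2] cancels the
    base change at vertex 2. *)
Lemma std_cfun_equivariant a1 a2 (g : mx_triple k n a1 a2) (M : krep k n a1 a2) :
  in_GL g ->
  col_mx (lin_mulmxr (arrows_mx N)) (homs_mx b2 M)
    *m (lin_mulmx (invmx g.1.1) *m lin_mulmxr (tens_rep rho2 g.2)) =
  block_mx (lin_mulmx (invmx g.1.1) *m lin_mulmxr (rho1 g.2)) 0
           0 (lin_mulmx (invmx g.1.2) *m lin_mulmxr (rho2 g.2))
    *m col_mx (lin_mulmxr (arrows_mx N)) (homs_mx b2 (GL_act (GL_inv g) M)).
Proof.
move=> gG; have [u1 u2 u3] := gG.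
rewrite mul_col_mx mul_block_col !mul0mx addr0 add0r; congr col_mx.
  apply: eq_mx_mxvec => x.
  rewrite !mulmxA !mul_lin_mulmx !mul_lin_mulmxr mul_lin_mulmx mul_lin_mulmxr.
  by rewrite -!mulmxA; have /equivariantP -> := eqN.
apply: eq_mx_mxvec => v.
rewrite !mulmxA !mul_homs_mx !mul_lin_mulmx !mul_lin_mulmxr mul_homs_mx.
congr mxvec; rewrite -mulmxA arrows_mx_tens_rep -arrows_mx_mull.
apply: eq_arrows_mx => i; rewrite GL_actVE // !mulmxA mulmxK //.
rewrite -!mulmxA; congr (_ *m _).
by rewrite mulmx_suml; apply: eq_bigr => j _; rewrite -scalemxAl mulmxA.
Qed.

Theorem cfun_semi_invariant (R : inj_resolution N) a1 a2 :
  euler_form n a1 a2 b1 b2 = 0 ->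
  semi_invariant (@cfun k n _ _ N R a1 a2).
Proof.
move=> euler; have [c cE] := cfun_std R euler.
have sq : (a1 * b1 + a2 * b2 = a1 * (n * b2))%N.
  move: euler; rewrite /euler_form => /eqP; rewrite subr_eq0 -PoszD => /eqP[->].
  by nia.
split.
  apply: (polyfun_ext (polyfunM (polyfun_const _ c) (polyfun_std_cfun sq))) => M.
  by rewrite cE.
have cP1 m := poly_char_det_lin_mulmx k a1 m.
have cP2 := poly_char_det_lin_mulmx k a2 b2.
have cPt := poly_char_det (poly_rep_lin_mulmxr a1 (poly_rep_tens rep2)).
have cP3 := poly_char_det (poly_rep_lin_mulmxr a1 rep1).
have cP4 := poly_char_det (poly_rep_lin_mulmxr a2 rep2).
(* The character is the determinant on the target divided by those of the two source blocks in
   [std_cfun_equivariant]; factors at [g.1.1] and [g.1.2] are inverted there, so they change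
   sides. *)
eexists.
  apply: is_characterM (is_characterM (is_character_trd a1 a2 cPt).1
                                      (is_character_fst n a2 (cP1 (n * b2)%N)).2) _.
  apply: is_characterM (is_characterM (is_character_trd a1 a2 cP3).2
                                      (is_character_fst n a2 (cP1 b1)).1) _.
  apply: is_characterM (is_character_trd a1 a2 cP4).2
                       (is_character_snd n a1 cP2).1.
move=> g gG M; have [u1 u2 u3] := gG; rewrite !cE mulrCA; congr (_ * _).
have := congr1 (@sqdet k _ _) (std_cfun_equivariant M gG).
rewrite [LHS]sqdetM // [RHS]sqdetM // -!/(std_cfun _ _) !sqdetE det_ublock.
rewrite !det_mulmx.
rewrite (poly_charV (cP1 b1) u1) (poly_charV (cP1 _) u1) (poly_charV cP2 u2).
have nz1 := poly_char_neq0 (cP1 b1) u1.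
have nz2 := poly_char_neq0 cP2 u2.
have nz3 := poly_char_neq0 cP3 u3.
have nz4 := poly_char_neq0 cP4 u3.
have nz5 := poly_char_neq0 (cP1 (n * b2)%N) u1.
move=> /= eqT; move: eqT nz1 nz2 nz3 nz4 nz5.
move: (std_cfun N (GL_act _ _)) (std_cfun N M) => x y.
move: (\det _) (\det _) (\det _) (\det _) (\det _) (\det _) => q p v u t s.
move=> eqT u0 p0 v0 q0 s0.
transitivity (v^-1 * u * (q^-1 * p) * (y * (s^-1 * t))).
  by rewrite eqT; field; rewrite u0 v0 p0 q0.
by ring.
Qed.

End SemiInvariance.
End Equivariance.

Section Subrepresentations.
Variables (k : fieldType) (n b1 b2 d : nat) (N : krep k n b1 b2).
Variables (rho : 'M[k]_n -> 'M[k]_b2) (C : 'M[k]_(n, b2) -> Prop).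

(** If the tuples [(v *m N i)_i] are exactly those satisfying an invariant
    condition [C], then they form a subrepresentation of [tens_rep rho]. *)
Lemma subrep_exists :
  poly_rep d rho ->
  (forall v : 'rV_b1, (forall i, v *m N i = 0) -> v = 0) ->
  (forall v : 'rV_b1, C (\matrix_i (v *m N i))) ->
  (forall X, C X -> exists v : 'rV_b1, forall i, row i X = v *m N i) ->
  (forall g X, C X -> C (g^T *m X *m rho g)) ->
  exists2 rho1, poly_rep d.+1 rho1 & equivariant rho1 rho N.
Proof.
move=> rep injN CN spanN invC; set nu := arrows_mx N.
have nuE (v : 'rV_b1) : v *m nu = mxvec (\matrix_i (v *m N i)).
  rewrite /nu -arrows_mx_mull; apply/row_matrixP => r; rewrite rowK row_id.
  by congr mxvec; apply/row_matrixP => i; rewrite !rowK row_id.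
have free_nu : row_free nu.
  apply: inj_row_free => v; rewrite nuE => /(congr1 vec_mx).
  rewrite mxvecK linear0 => /row_matrixP v0; apply: injN => i.
  by have := v0 i; rewrite rowK row0.
have stab g : (nu *m tens_rep rho g <= nu)%MS.
  apply/row_subP => r; rewrite rowE mulmxA nuE mul_tens_rep.
  have [v vE] := spanN _ (invC g _ (CN (delta_mx 0 r))).
  apply/submxP; exists v; rewrite nuE; congr mxvec.
  by apply/row_matrixP => i; rewrite rowK.
have [rp rM rC] := poly_rep_tens rep.
(* The matrix of [tens_rep rho g] restricted to the stable row space of [nu], in the basis of its
   rows. It is polynomial in [g] because [pinvmx nu] is constant. *)
pose rho1 g := nu *m tens_rep rho g *m pinvmx nu.
have rho1E g : rho1 g *m nu = nu *m tens_rep rho g by rewrite mulmxKpV.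
have cancel_nu (A B : 'M_b1) : A *m nu = B *m nu -> A = B.
  by move=> eqAB; apply: (row_free_inj free_nu).
exists rho1; last by apply/equivariantP.
split.
- exact: (polymxM (polymxM (polymx_const _ nu) rp) (polymx_const _ _)).
- move=> g h; apply: cancel_nu; rewrite -[RHS]mulmxA !rho1E rM.
  by rewrite [LHS]mulmxA [RHS]mulmxA rho1E.
- move=> c; apply: cancel_nu.
  by rewrite rho1E rC mul_mx_scalar mul_scalar_mx.
Qed.

End Subrepresentations.

(** * Tensors of order three under [GL_3] *)

Section TensorAction.
Variable k : fieldType.
Implicit Types (g : 'M[k]_3) (T : 'I_3 -> 'I_3 -> 'I_3 -> k).

Definition tensor_act g T i p q : k :=
  \sum_j \sum_a \sum_b g j i * g a p * g b q * T j a b.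

Lemma eq_tensor_act g T T' i p q :
  (forall j a b, T j a b = T' j a b) ->
  tensor_act g T i p q = tensor_act g T' i p q.
Proof.
move=> eqT; apply: eq_bigr => j _; apply: eq_bigr => a _.
by apply: eq_bigr => b _; rewrite eqT.
Qed.

Lemma tensor_actD g T T' i p q :
  tensor_act g (fun j a b => T j a b + T' j a b) i p q =
  tensor_act g T i p q + tensor_act g T' i p q.
Proof.
rewrite -big_split; apply: eq_bigr => j _ /=; rewrite -big_split.
apply: eq_bigr => a _ /=; rewrite -big_split.
by apply: eq_bigr => b _; rewrite mulrDr.
Qed.

Lemma tensor_actZ c g T i p q :
  tensor_act g (fun j a b => c * T j a b) i p q = c * tensor_act g T i p q.
Proof.
rewrite mulr_sumr; apply: eq_bigr => j _; rewrite mulr_sumr.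
apply: eq_bigr => a _; rewrite mulr_sumr.
by apply: eq_bigr => b _; rewrite mulrCA.
Qed.

(** The same [g] acts in all three slots, so the action commutes with permuting them; this
    transposition and the rotation below generate all permutations. *)
Lemma tensor_act_swap g T i p q :
  tensor_act g (fun j a b => T a j b) i p q = tensor_act g T p i q.
Proof.
rewrite /tensor_act exchange_big; apply: eq_bigr => j _; apply: eq_bigr => a _.
by apply: eq_bigr => b _; rewrite (mulrC (g a i)).
Qed.

Lemma tensor_act_rot g T i p q :
  tensor_act g (fun j a b => T a b j) i p q = tensor_act g T p q i.
Proof.
rewrite /tensor_act exchange_big; apply: eq_bigr => j _; rewrite exchange_big.
apply: eq_bigr => a _; apply: eq_bigr => b _; congr (_ * _).
by rewrite -mulrA mulrC.
Qed.

Section Embedding.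
Variables (m : nat) (S : krep k 3 m 3) (rho : 'M[k]_3 -> 'M[k]_m).
Hypothesis eqS : equivariant rho id S.

Lemma mulmx_rho_emb a (A : 'M[k]_(a, m)) g p r q :
  (A *m rho g *m S p) r q =
  \sum_a \sum_b g a p * g b q * (A *m S a) r b.
Proof.
rewrite -mulmxA eqS mulmx_sumr summxE; apply: eq_bigr => c _.
rewrite -scalemxAr mulmxA [LHS]mxE [X in _ * X]mxE mulr_sumr.
by apply: eq_bigr => b _; rewrite [X in _ * X]mulrC mulrA.
Qed.

(** Via [S] a row vector of length [m] is a 3 by 3 matrix, on which [rho] acts as on [W (x) W];
    hence [tens_rep rho] becomes the action on tensors of order three. *)
Lemma tens_emb_tensor_act g (X : 'M[k]_(3, m)) i p q :
  (g^T *m X *m rho g *m S p) i q = tensor_act g (fun j a b => (X *m S a) j b) i p q.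
Proof.
rewrite -!mulmxA mxE; apply: eq_bigr => j _; rewrite mulmxA mulmx_rho_emb mxE.
rewrite mulr_sumr; apply: eq_bigr => a _; rewrite mulr_sumr.
by apply: eq_bigr => b _; rewrite !mulrA.
Qed.

Lemma krep_emb_tensor_act a (N : krep k 3 a m) g r i p q :
  ((\sum_j g j i *: (N j *m rho g)) *m S p) r q =
  tensor_act g (fun j a b => (N j *m S a) r b) i p q.
Proof.
rewrite mulmx_suml summxE; apply: eq_bigr => j _.
rewrite -scalemxAl mxE mulmx_rho_emb mulr_sumr; apply: eq_bigr => c _.
by rewrite mulr_sumr; apply: eq_bigr => b _; rewrite !mulrA.
Qed.

End Embedding.

End TensorAction.

(** * Entries of products with explicit matrices *)

Section Entries.
Variable k : fieldType.

(** Rows of [E] count from 1 and [inord p] from 0. Writing the entry as a multiple by a boolean lets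
    it reduce at concrete indices. *)
Lemma mulmx_E a m n (v : 'M[k]_(a, m.+1)) p q r (j : 'I_n) : (p < m.+1)%N ->
  (v *m E k m.+1 n p.+1 q) r j = v r (inord p) *+ (j.+1 == q).
Proof.
move=> ltpm; rewrite mxE (bigD1 (inord p)) //= big1 ?addr0 => [|i].
  by rewrite mxE inordK // eqxx mulr_natr.
by rewrite mxE -val_eqE /= inordK // eqSS => /negbTE->; rewrite mulr0.
Qed.

Lemma mulmx_ZE a m n (v : 'M[k]_(a, m.+1)) c p q r (j : 'I_n) : (p < m.+1)%N ->
  (v *m (c *: E k m.+1 n p.+1 q)) r j = c * v r (inord p) *+ (j.+1 == q).
Proof. by move=> ltpm; rewrite -scalemxAr mxE mulmx_E // mulrnAr. Qed.

Lemma mulmx_DE a m n (v : 'M[k]_(a, m)) (A B : 'M[k]_(m, n)) r j :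
  (v *m (A + B)) r j = (v *m A) r j + (v *m B) r j.
Proof. by rewrite mulmxDr mxE. Qed.

Lemma mulmx_NE a m n (v : 'M[k]_(a, m)) (A : 'M[k]_(m, n)) r j :
  (v *m - A) r j = - (v *m A) r j.
Proof. by rewrite mulmxN mxE. Qed.

Definition mulmxEE := (mulmx_DE, mulmx_NE, mulmx_ZE, mulmx_E).

Lemma forall_ord3 (P : 'I_3 -> Prop) :
  P (inord 0) -> P (inord 1) -> P (inord 2) -> forall i, P i.
Proof.
by move=> P0 P1 P2 i; rewrite -(inord_val i); case: i => [[|[|[]]]].
Qed.

Lemma krep3E m n (A1 A2 A3 : 'M[k]_(m, n)) :
  (krep3 A1 A2 A3 (inord 0) = A1) * (krep3 A1 A2 A3 (inord 1) = A2) *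
  (krep3 A1 A2 A3 (inord 2) = A3).
Proof. by rewrite /krep3 !inordK. Qed.

End Entries.

Ltac krep_simp :=
  rewrite ?(krep3E, mulmxEE) // ?inordK //= ?(mulr0n, mulr1n, addr0, add0r, oppr0).

(** * The blocks as explicit spaces of tensors *)

Section Models.
Variable k : fieldType.

Local Notation E := (E k _ _).

(** [v |-> (v *m Sym p)_p] identifies [k^6] with the symmetric matrices; the six
    basis vectors are [x1 x2, x1 x3, x2 x3, x1^2, x2^2, x3^2], in the order which
    [Ad] requires. *)
Definition Sym : krep k 3 6 3 :=
  krep3 (E 4 1 + E 1 2 + E 2 3) (E 1 1 + E 5 2 + E 3 3) (E 2 1 + E 3 2 + E 6 3).

(** The basis vectors of the skew matrices are [x1 ^ x2, x3 ^ x1, x2 ^ x3]. *)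
Definition Skew : krep k 3 3 3 :=
  krep3 (E 1 2 - E 2 3) (E 3 3 - E 1 1) (E 2 1 - E 3 2).

(** The case [b = 1], [B_i = 1] of the blocks. *)
Definition Au0 : krep k 3 1 3 :=
  krep3 (E 1 3) (E 1 2) (E 1 1).

Definition Al0 : krep k 3 8 3 :=
  krep3 (- 2 *: E 1 1 + 2 *: E 3 2 - E 7 3)
    (2 *: E 2 1 + 2 *: E 4 3 + E 7 2 - E 8 2)
    (2 *: E 5 2 + 2 *: E 6 3 + E 8 1).

Definition Ar0 : krep k 3 8 6 :=
  krep3
    (E 1 1 - 2 *: E 2 5 + E 3 2 + 2 *: E 5 6 + 2^-1 *: E 7 3 - E 8 3)
    (- 2 *: E 1 4 + E 2 1 - E 4 3 - 2 *: E 6 6 + 2^-1 *: E 7 2 + 2^-1 *: E 8 2)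
    (- 2 *: E 3 4 + 2 *: E 4 5 - E 5 2 + E 6 3 - E 7 1 + 2^-1 *: E 8 1).

Definition Ad0 : krep k 3 10 6 :=
  krep3
    (3 *: E 1 4 + E 4 1 + E 5 5 + E 6 2 + 2^-1 *: E 8 6 + 8^-1 *: E 10 3)
    (3 *: E 2 5 + E 4 4 + E 5 1 + 2^-1 *: E 7 3 + 4^-1 *: E 9 6 + 8^-1 *: E 10 2)
    (3 *: E 3 6 + E 6 4 + 2^-1 *: E 7 5 + 2^-1 *: E 8 2 + 4^-1 *: E 9 3
      + 8^-1 *: E 10 1).

Hypothesis nat_neq0 : forall m, m.+1%:R != 0 :> k.
Let two_neq0 : 2 != 0 :> k := nat_neq0 1.
Let three_neq0 : 3 != 0 :> k := nat_neq0 2.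
Let four_neq0 : 4 != 0 :> k := nat_neq0 3.
Let eight_neq0 : 8 != 0 :> k := nat_neq0 7.

Lemma eq_opp0 (x : k) : x = - x -> x = 0.
Proof.
move=> xE; apply: (mulfI two_neq0); rewrite mulr0 mulr_natl mulr2n {1}xE.
exact: addNr.
Qed.

Lemma Sym_inj a (A B : 'M_(a, 6)) : (forall p, A *m Sym p = B *m Sym p) -> A = B.
Proof.
move=> eqAB; apply/matrixP => r c; rewrite -(inord_val c).
have E p q : (A *m Sym p) r q = (B *m Sym p) r q by rewrite eqAB.
have := (E (inord 0) (inord 0), E (inord 0) (inord 1), E (inord 0) (inord 2),
  E (inord 1) (inord 1), E (inord 1) (inord 2), E (inord 2) (inord 2)).
rewrite /Sym; krep_simp => -[[[[[E0 E1] E2] E3] E4] E5].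
by case: c => [[|[|[|[|[|[|]]]]]] //= _].
Qed.

Lemma Sym_rep : exists2 rho, poly_rep 2 rho & equivariant rho id Sym.
Proof.
apply: (subrep_exists (C := fun X => forall p q, X p q = X q p)).
- exact: poly_rep_id.
- move=> v v0; apply: Sym_inj => p; rewrite v0.
  by rewrite mul0mx.
- move=> v p q; rewrite [LHS]mxE [in RHS]mxE; elim/forall_ord3: p;
  elim/forall_ord3: q => //=;
    by rewrite /Sym; krep_simp.
- move=> X XC.
  (* The positions of the six basis vectors of [Sym] on and above the diagonal. *)
  exists (\row_s X (inord (nth 0 [:: 0; 0; 1; 0; 1; 2] s)%N)
                   (inord (nth 0 [:: 1; 2; 2; 0; 1; 2] s)%N)) => i.
  apply/rowP => j; rewrite [LHS]mxE; elim/forall_ord3: i; elim/forall_ord3: j;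
  rewrite /Sym; krep_simp; rewrite ?mxE ?inordK //=;
  first [done | by rewrite XC].
- move=> g X XC p q; have XT : X^T = X by apply/matrixP => i j; rewrite mxE XC.
  have gXgT : (g^T *m X *m g)^T = g^T *m X *m g.
    by rewrite !trmx_mul trmxK XT mulmxA.
  by rewrite -{1}gXgT mxE.
Qed.

Lemma Skew_rep : exists2 rho, poly_rep 2 rho & equivariant rho id Skew.
Proof.
apply: (subrep_exists (C := fun X => forall p q, X p q = - X q p)).
- exact: poly_rep_id.
- move=> v v0; apply/rowP => c; rewrite mxE -(inord_val c).
  have v0E p q : (v *m Skew p) 0 q = 0 by rewrite v0 mxE.
  have := (v0E (inord 0) (inord 1), v0E (inord 2) (inord 0), v0E (inord 1) (inord 2)).
  rewrite /Skew; krep_simp => -[[E0 E1] E2].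
  by case: c => [[|[|[|]]] //= _].
- move=> v p q; rewrite [LHS]mxE [in RHS]mxE; elim/forall_ord3: p;
  elim/forall_ord3: q => //=;
  by rewrite /Skew; krep_simp; rewrite ?opprK.
- move=> X XC; have XD p : X p p = 0 by apply: eq_opp0.
  exists (\row_s X (inord (nth 0 [:: 0; 2; 1] s)%N)
                   (inord (nth 0 [:: 1; 0; 2] s)%N)) => i.
  apply/rowP => j; rewrite [LHS]mxE; elim/forall_ord3: i; elim/forall_ord3: j;
  rewrite /Skew; krep_simp; rewrite ?mxE ?inordK //= ?XD;
  first [done | by rewrite XC ?opprK].
- move=> g X XC p q.
  have XT : X^T = - X by apply/matrixP => i j; rewrite !mxE XC.
  have gXgT : g^T *m X *m g = - (g^T *m X *m g)^T.
    by rewrite !trmx_mul trmxK XT mulNmx mulmxN opprK mulmxA.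
  by rewrite {1}gXgT [LHS]mxE [X in - X]mxE.
Qed.

(** This is the equivariant map from the rows of [Al0] to those of [Ar0]: with [T] the tensor of
    [Al0], that of [Ar0] at [(i, p, q)] is [-1/2] times [T(p, i, q) + T(q, i, p)]. The 27 index
    triples are checked one by one. *)
Lemma Ar0_Al0 a (v : 'M_(a, 8)) i p q r :
   - 2 * (v *m Ar0 i *m Sym p) r q =
  (v *m Al0 p *m Skew i) r q + (v *m Al0 q *m Skew i) r p.
Proof.
elim/forall_ord3: i; elim/forall_ord3: p; elim/forall_ord3: q;
rewrite /Sym /Skew; krep_simp; rewrite /Ar0 /Al0; krep_simp; by field.
Qed.

Variables (rho3 : 'M[k]_3 -> 'M[k]_3) (rho6 : 'M[k]_3 -> 'M[k]_6).
Hypotheses (rep3 : poly_rep 2 rho3) (eq3 : equivariant rho3 id (Skew)).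
Hypotheses (rep6 : poly_rep 2 rho6) (eq6 : equivariant rho6 id (Sym)).

Lemma mul_row_entry a m n (v : 'rV[k]_a) (N : krep k m a n) p (S : 'M[k]_(n, p)) i q :
  ((\matrix_i (v *m N i)) *m S) i q = (v *m N i *m S) 0 q.
Proof.
by rewrite -[v *m N i](rowK (fun i => v *m N i)) -row_mul [RHS]mxE.
Qed.

Lemma Au_rep : exists2 rho, poly_rep 3 rho & equivariant rho rho3 (Au0).
Proof.
apply: (subrep_exists
  (* Skewness in the last two slots is built into [Skew]; a sign under swapping the first two makes
     the tensor alternating. *)
  (C := fun X => forall i p q, (X *m Skew p) i q = - (X *m Skew i) p q)) => //.
- move=> v v0; apply/rowP => c; rewrite [RHS]mxE -(inord_val c).
  have := congr1 (fun w : 'rV_3 => w 0 (inord 0)) (v0 (inord 2)).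
  rewrite /Au0; krep_simp; rewrite [RHS]mxE => v00.
  by case: c => [[|] //= _].
- move=> v i p q; rewrite !mul_row_entry.
  elim/forall_ord3: i; elim/forall_ord3: p; elim/forall_ord3: q;
  by rewrite /Au0 /Skew; krep_simp; rewrite ?opprK.
- move=> X XC; exists (\row_s X (inord 0) (inord 2)) => i.
  (* The six instances with a repeated index kill six entries of [X]; the last two equate the
     remaining three. *)
  have := (XC (inord 0) (inord 0) (inord 1), XC (inord 0) (inord 0) (inord 2),
           XC (inord 1) (inord 1) (inord 0), XC (inord 1) (inord 1) (inord 2),
           XC (inord 2) (inord 2) (inord 0), XC (inord 2) (inord 2) (inord 1),
           XC (inord 0) (inord 1) (inord 2), XC (inord 0) (inord 2) (inord 1)).
  rewrite /Skew; krep_simp; rewrite ?opprK.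
  case; case; case; case; case; case; case.
  move=> /(eq_opp0) Z0 /esym/(eq_opp0) Z1.
  move=> /esym/(eq_opp0) Z2 /(eq_opp0) Z3.
  move=> /(eq_opp0) Z4 /esym/(eq_opp0) Z5 Z6 /oppr_inj Z7.
  apply/rowP => j; rewrite [LHS]mxE; elim/forall_ord3: i; elim/forall_ord3: j;
  by rewrite /Au0; krep_simp; rewrite mxE.
- move=> g X XC i p q; rewrite !(tens_emb_tensor_act eq3).
  rewrite -[RHS]mulN1r -[in RHS]tensor_act_swap -tensor_actZ.
  by apply: eq_tensor_act => j a b; rewrite mulN1r XC.
Qed.

Lemma Al_rep : exists2 rho, poly_rep 3 rho & equivariant rho rho3 (Al0).
Proof.
apply: (subrep_exists (C := fun X => forall i p q,
  (X *m Skew p) i q + (X *m Skew q) p i + (X *m Skew i) q p = 0)) => //.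
- move=> v v0; apply/rowP => c; rewrite [RHS]mxE -(inord_val c).
  have E i s : (v *m Al0 i) 0 s = 0 by rewrite v0 mxE.
  have := (E (inord 0) (inord 0), E (inord 1) (inord 0), E (inord 0) (inord 1),
    E (inord 1) (inord 2), E (inord 2) (inord 1), E (inord 2) (inord 2),
    E (inord 0) (inord 2), E (inord 2) (inord 0)).
  rewrite /Al0; krep_simp => -[[[[[[[E0 E1] E2] E3] E4] E5] E6] E7].
  have two0 (x : k) : 2 * x = 0 -> x = 0.
    by move/eqP; rewrite mulf_eq0 (negbTE two_neq0) => /eqP.
  case: c => [[|[|[|[|[|[|[|[|]]]]]]]] //= _]; try exact: two0.
    by apply: two0; rewrite -[LHS]opprK -mulNr E0 oppr0.
  by rewrite -[LHS]opprK E6 oppr0.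
- move=> v i p q; rewrite !mul_row_entry.
  elim/forall_ord3: i; elim/forall_ord3: p; elim/forall_ord3: q;
  by rewrite /Skew; krep_simp; rewrite /Al0; krep_simp; ring.
- move=> X XC.
  exists (\row_s nth 0 [:: - 2^-1 * X (inord 0) (inord 0);
    2^-1 * X (inord 1) (inord 0); 2^-1 * X (inord 0) (inord 1);
    2^-1 * X (inord 1) (inord 2); 2^-1 * X (inord 2) (inord 1);
    2^-1 * X (inord 2) (inord 2); - X (inord 0) (inord 2); X (inord 2) (inord 0)] s).
  (* The cyclic sum is alternating, so this is the only relation: it ties the entries (0,2), (1,1),
     (2,0) and leaves the eight coordinates above free. *)
  move=> i; have := XC (inord 0) (inord 1) (inord 2).
  rewrite /Skew; krep_simp => /eqP; rewrite addr_eq0 => /eqP XE.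
  apply/rowP => j; rewrite [LHS]mxE; elim/forall_ord3: i; elim/forall_ord3: j;
  rewrite /Al0; krep_simp; rewrite !mxE !inordK //=;
  first [by field | by rewrite -XE; ring].
- move=> g X XC i p q; rewrite !(tens_emb_tensor_act eq3).
  rewrite -2![in X in _ + X = _]tensor_act_rot -[in X in _ + X + _]tensor_act_rot.
  rewrite -!tensor_actD.
  rewrite -[RHS](mul0r (tensor_act g (fun _ _ _ => 0) i p q)) -tensor_actZ.
  by apply: eq_tensor_act => j a b; rewrite mul0r XC.
Qed.

Lemma Ad_rep : exists2 rho, poly_rep 3 rho & equivariant rho rho6 (Ad0).
Proof.
(* Symmetry in the last two slots comes from [Sym]; with symmetry in the first two the tensor is
   fully symmetric. *)
apply: (subrep_exists (C := fun X => forall i p q,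
  (X *m Sym p) i q = (X *m Sym i) p q)) => //.
- move=> v v0; apply/rowP => c; rewrite [RHS]mxE -(inord_val c).
  have E i s : (v *m Ad0 i) 0 s = 0 by rewrite v0 mxE.
  have := (E (inord 0) (inord 3), E (inord 1) (inord 4), E (inord 2) (inord 5),
    E (inord 0) (inord 0), E (inord 0) (inord 4), E (inord 0) (inord 1),
    E (inord 1) (inord 2), E (inord 0) (inord 5), E (inord 1) (inord 5),
    E (inord 0) (inord 2)).
  rewrite /Ad0; krep_simp => -[[[[[[[[[E0 E1] E2] E3] E4] E5] E6] E7] E8] E9].
  have nz0 m (x : k) : m.+1%:R * x = 0 -> x = 0.
    by move/eqP; rewrite mulf_eq0 (negbTE (nat_neq0 m)) => /eqP.
  have nzV m (x : k) : m.+1%:R^-1 * x = 0 -> x = 0.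
    by move/eqP; rewrite mulf_eq0 invr_eq0 (negbTE (nat_neq0 m)) => /eqP.
  case: c => [[|[|[|[|[|[|[|[|[|[|]]]]]]]]]] //= _];
  [exact: nz0 E0 | exact: nz0 E1 | exact: nz0 E2 | exact: nzV E6 | exact: nzV E7
  | exact: nzV E8 | exact: nzV E9].
- move=> v i p q; rewrite !mul_row_entry.
  elim/forall_ord3: i; elim/forall_ord3: p; elim/forall_ord3: q;
  by rewrite /Sym; krep_simp; rewrite /Ad0; krep_simp.
- move=> X XC.
  (* Each coordinate is read off one entry where it occurs alone, divided by its coefficient in
     [Ad0]. The eight relations below account for the difference between 18 entries and 10
     coordinates. *)
  exists (\row_s nth 0 [:: 3^-1 * X (inord 0) (inord 3);
    3^-1 * X (inord 1) (inord 4); 3^-1 * X (inord 2) (inord 5);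
    X (inord 0) (inord 0); X (inord 0) (inord 4); X (inord 0) (inord 1);
    2 * X (inord 1) (inord 2); 2 * X (inord 0) (inord 5);
    4 * X (inord 1) (inord 5); 8 * X (inord 0) (inord 2)] s).
  have := (XC (inord 1) (inord 0) (inord 0), XC (inord 1) (inord 0) (inord 1),
    XC (inord 1) (inord 0) (inord 2), XC (inord 2) (inord 0) (inord 0),
    XC (inord 2) (inord 0) (inord 1), XC (inord 2) (inord 0) (inord 2),
    XC (inord 2) (inord 1) (inord 1), XC (inord 2) (inord 1) (inord 2)).
  rewrite /Sym; krep_simp => -[[[[[[[X0 X1] X2] X3] X4] X5] X6] X7] i.
  apply/rowP => j; rewrite [LHS]mxE -(inord_val j); elim/forall_ord3: i;
  case: j => [[|[|[|[|[|[|]]]]]] //= _];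
  rewrite /Ad0; krep_simp; rewrite !mxE !inordK //=;
  rewrite ?(X2, X4, X5, X6, X7); by field.
- move=> g X XC i p q; rewrite !(tens_emb_tensor_act eq6) -[RHS]tensor_act_swap.
  exact: eq_tensor_act.
Qed.

(** By [Ar0_Al0] the tensors of [Ar0] arise from those of [Al0] by permuting slots and adding, which
    commutes with [tensor_act]; so the same [rho8] serves both. The comparison is made after the
    injective map [Sym] and a factor [-2]. *)
Lemma Ar_equivariant rho8 :
  equivariant rho8 rho3 (Al0) -> equivariant rho8 rho6 (Ar0).
Proof.
move=> eq8 g i; apply: Sym_inj => p; apply/matrixP => r q.
have m2_neq0 : - 2 != 0 :> k by rewrite oppr_eq0.
apply: (mulfI m2_neq0).
rewrite (krep_emb_tensor_act eq6) -tensor_actZ Ar0_Al0 // !eq8.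
rewrite !(krep_emb_tensor_act eq3).
have -> : tensor_act g (fun j a b => - 2 * (Ar0 j *m Sym a) r b) i p q =
   tensor_act g (fun j a b => (Al0 a *m Skew j) r b + (Al0 b *m Skew j) r a) i p q.
  apply: eq_tensor_act => j a b.
  by have := Ar0_Al0 1%:M j a b r; rewrite !mul1mx.
rewrite tensor_actD tensor_act_swap; congr (_ + _).
by rewrite -tensor_act_rot -tensor_act_rot.
Qed.

End Models.

(** * Assembling equivariant representations from blocks *)

Section EquivariantClosure.
Variables (k : fieldType) (n : nat).

Lemma equivariant_ext b1 b2 rho1 rho2 (N N' : krep k n b1 b2) :
  N =1 N' -> equivariant rho1 rho2 N -> equivariant rho1 rho2 N'.
Proof.
by move=> eqN eqvN g i; rewrite -eqN eqvN; apply: eq_bigr => j _; rewrite eqN.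
Qed.

Lemma equivariant0 b1 b2 (rho1 : 'M[k]_n -> 'M[k]_b1) (rho2 : 'M[k]_n -> 'M[k]_b2) :
  equivariant rho1 rho2 (fun=> 0).
Proof.
by move=> g i; rewrite mulmx0 big1 // => j _; rewrite mul0mx scaler0.
Qed.

Lemma equivariant_row b1 b2 b2' (rho1 : 'M[k]_n -> 'M[k]_b1)
    (rho2 : 'M[k]_n -> 'M[k]_b2) (rho2' : 'M[k]_n -> 'M[k]_b2')
    (N : krep k n b1 b2) (N' : krep k n b1 b2') :
  equivariant rho1 rho2 N -> equivariant rho1 rho2' N' ->
  equivariant rho1 (fun g => block_mx (rho2 g) 0 0 (rho2' g))
    (fun i => row_mx (N i) (N' i)).
Proof.
move=> eqN eqN' g i; rewrite mul_mx_row eqN eqN'.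
under [RHS]eq_bigr => j _ do
  rewrite mul_row_block !mulmx0 addr0 add0r scale_row_mx.
by elim: (index_enum _) => [|j s IHs];
   rewrite ?(big_nil, row_mx0) // !big_cons -add_row_mx IHs.
Qed.

Lemma equivariant_col b1 b1' b2 (rho1 : 'M[k]_n -> 'M[k]_b1)
    (rho1' : 'M[k]_n -> 'M[k]_b1') (rho2 : 'M[k]_n -> 'M[k]_b2)
    (N : krep k n b1 b2) (N' : krep k n b1' b2) :
  equivariant rho1 rho2 N -> equivariant rho1' rho2 N' ->
  equivariant (fun g => block_mx (rho1 g) 0 0 (rho1' g)) rho2
    (fun i => col_mx (N i) (N' i)).
Proof.
move=> eqN eqN' g i; rewrite mul_block_col !mul0mx addr0 add0r eqN eqN'.
under [RHS]eq_bigr => j _ do rewrite mul_col_mx scale_col_mx.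
by elim: (index_enum _) => [|j s IHs];
   rewrite ?(big_nil, col_mx0) // !big_cons -add_col_mx IHs.
Qed.

Lemma equivariant_tens1 b b1 b2 (rho1 : 'M[k]_n -> 'M[k]_b1)
    (rho2 : 'M[k]_n -> 'M[k]_b2) (N : krep k n b1 b2) (B : 'M[k]_b) :
  equivariant rho1 rho2 N ->
  equivariant (fun g => rho1 g *t (1%:M : 'M_b)) (fun g => rho2 g *t (1%:M : 'M_b))
    (fun i => N i *t B).
Proof.
move=> eqN g i; rewrite tensmx_mul mul1mx eqN; apply/matrixP => r s.
rewrite mxE !summxE mulr_suml; apply: eq_bigr => j _.
by rewrite tensmx_mul mulmx1 !mxE mulrA.
Qed.

End EquivariantClosure.

Theorem proposition4p4 (k : fieldType) (char0 : [pchar k] =i pred0)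
    (b : nat) (hb : (1 <= b)%N) :
  holds_generally (@quad_coord k b) (fun B : quad k b =>
    let: (B1, B2, B3, B4) := B in
    forall a : nat, (1 <= a)%N ->
      [/\ forall R : inj_resolution (N1 B3),
            semi_invariant (@cfun k 3 _ _ (N1 B3) R (3 * a) (5 * a)),
          forall R : inj_resolution (N2 B4),
            semi_invariant (@cfun k 3 _ _ (N2 B4) R (3 * a) (4 * a)),
          forall R : inj_resolution (N3 B2 B3),
            semi_invariant (@cfun k 3 _ _ (N3 B2 B3) R (9 * a) (19 * a)),
          forall R : inj_resolution (N4 B2 B3 B4),
            semi_invariant (@cfun k 3 _ _ (N4 B2 B3 B4) R a a)
        & forall R : inj_resolution (N5 B1 B2 B3 B4),
            semi_invariant (@cfun k 3 _ _ (N5 B1 B2 B3 B4) R (9 * a) (8 * a))]).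
Proof.
have nat_neq0 m : m.+1%:R != 0 :> k by have /pcharf0P -> := char0.
(* The open set is the whole space: the equivariance argument applies to every quadruple of
   blocks. *)
exists (fun=> True); split; last 1 first.
- move=> [[[B1 B2] B3] B4] _ a _.
  have [rho6 rep6 eq6] := Sym_rep k.
  have [rho3 rep3 eq3] := Skew_rep nat_neq0.
  have [rho1 rep1 eq1] := Au_rep nat_neq0 rep3 eq3.
  have [rho8 rep8 eq8] := Al_rep nat_neq0 rep3 eq3.
  have [rho10 rep10 eq10] := Ad_rep nat_neq0 rep6 eq6.
  have eq8' := Ar_equivariant nat_neq0 eq3 eq6 eq8.
  have tens c1 c2 (M1 M2 M3 : 'M[k]_(c1, c2)) (B : 'M[k]_b) :
      (fun i => krep3 M1 M2 M3 i *t B) =1 krep3 (M1 *t B) (M2 *t B) (M3 *t B).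
    by case=> [[|[|[|]]]].
  have equ := equivariant_ext (tens _ _ _ _ _ B1) (equivariant_tens1 B1 eq1).
  have eql := equivariant_ext (tens _ _ _ _ _ B2) (equivariant_tens1 B2 eq8).
  have eqr := equivariant_ext (tens _ _ _ _ _ B3) (equivariant_tens1 B3 eq8').
  have eqd := equivariant_ext (tens _ _ _ _ _ B4) (equivariant_tens1 B4 eq10).
  have repT := fun m d rho => @poly_rep_tens1 k 3 m b d rho.
  have rep36 := poly_rep_block_diag (repT _ _ _ rep3) (repT _ _ _ rep6).
  have rep810 := poly_rep_block_diag (repT _ _ _ rep8) (repT _ _ _ rep10).
  (* [Al] and [Ar] can stand side by side because they share the row representation [rho8]; zero
     blocks are equivariant for any pair. *)
  have eq_lr := equivariant_row eql eqr.
  have eq_N4 := equivariant_col eq_lr (equivariant_row (equivariant0 _ _) eqd).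
  have eq_N5 := equivariant_col (equivariant_row equ (equivariant0 _ _)) eq_N4.
  have [e1 e2 e3 e4 e5] := euler_form_N a b.
  split=> R.
  + exact: (cfun_semi_invariant (repT _ _ _ rep8) (repT _ _ _ rep6) eqr).
  + exact: (cfun_semi_invariant (repT _ _ _ rep10) (repT _ _ _ rep6) eqd).
  + exact: (cfun_semi_invariant (repT _ _ _ rep8) rep36 eq_lr).
  + apply: (cfun_semi_invariant rep810 rep36) e4.
    apply: equivariant_ext eq_N4 => i; exact/esym/block_mxEv.
  + apply: (cfun_semi_invariant
      (poly_rep_block_diag (repT _ _ _ rep1) rep810) rep36) e5.
    apply: equivariant_ext eq_N5 => i; congr col_mx; exact/esym/block_mxEv.
(* The whole space is the nonvanishing locus of the polynomial 1. *)
- exists (fun p => p = 1) => x; split=> // _; exists 1 => //.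
  by rewrite /peval meval1; apply/eqP/oner_neq0.
- by exists (0, 0, 0, 0).
Qed.
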